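(* Let $\{A_n\}_{n\in\mathbb N}$ and $\{B_n\}_{n\in\mathbb N}$ be two sequences of nonnegative selfadjoint linear relations in a complex Hilbert space $\mathcal H$, and let $A_\infty,B_\infty$ be nonnegative selfadjoint linear relations in $\mathcal H$. (i) If $\{A_n\}$ and $\{B_n\}$ are non-decreasing and converge in the strong resolvent sense to $A_\infty$ and $B_\infty$, respectively, then $\{A_n\dot+B_n\}$ is non-decreasing and converges in the strong resolvent sense to $A_\infty\dot+B_\infty$. (ii) If $\{A_n\}$ and $\{B_n\}$ are non-increasing and converge in the strong resolvent sense to $A_\infty$ and $B_\infty$, respectively, then $\{A_n:B_n\}$ is non-increasing and converges in the strong resolvent sense to $A_\infty:B_\infty$.
   Context: A linear relation (l.r.) in $\mathcal H$ is a closed linear subspace $A=\{\{f,f'\}\}$ of $\mathcal H\oplus\mathcal H$; $\operatorname{mul}A=\{f':\{0,f'\}\in A\}$; $A^{-1}=\{\{f',f\}:\{f,f'\}\in A\}$. $A$ is selfadjoint if $A=A^*:=\{\{g,g'\}:(f',g)=(f,g')\ \forall\{f,f'\}\in A\}$, nonnegative if $(f',f)\ge0$ for all $\{f,f'\}\in A$. A nonnegative selfadjoint l.r. decomposes as $A=\mathrm{Graph}(A_o)\oplus(\{0\}\oplus\operatorname{mul}A)$ with $A_o$ a nonnegative selfadjoint operator in $\mathcal H\ominus\operatorname{mul}A$. The closed form of $A$ is $A[\varphi]=\|A_o^{1/2}\varphi\|^2$, $\varphi\in\mathcal D[A]=\operatorname{dom}A_o^{1/2}$; this gives a bijection between nonnegative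 selfadjoint l.r. and closed nonnegative (not necessarily densely defined) forms. The order $A_1\ge A_2$ means $\mathcal D[A_1]\subseteq\mathcal D[A_2]$ and $A_1[\varphi]\ge A_2[\varphi]$ for all $\varphi\in\mathcal D[A_1]$. The form sum $A\dot+B$ is the nonnegative selfadjoint l.r. associated with the closed form $A[\varphi]+B[\varphi]$, $\varphi\in\mathcal D[A]\cap\mathcal D[B]$. The parallel sum is $A:B:=(A^{-1}\dot+B^{-1})^{-1}$. $A_n\to A$ in the strong resolvent sense means $(A_n+I)^{-1}\to(A+I)^{-1}$ strongly. *)

(* Defs.v *)
From HB Require Import structures.
From mathcomp Require Import all_boot all_order all_algebra.
From mathcomp Require Import complex.
From mathcomp Require Import all_classical all_reals all_analysis.
Import Order.TTheory GRing.Theory Num.Theory.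
Import numFieldNormedType.Exports.
Set Implicit Arguments.
Unset Strict Implicit.
Unset Printing Implicit Defensive.
Local Open Scope classical_set_scope.
Local Open Scope complex_scope.
Local Open Scope ring_scope.

(* Complex Hilbert spaces: complete normed spaces over R[i] whose norm comes
   from a dot product, linear in its first argument and conjugate-linear in
   its second one. *)
HB.mixin Record isHilbert (R : realType) H of CompleteNormedModule R[i] H := {
  dotp : {dot H for (@Num.conj R[i])} ;
  norm_dotp : forall x : H, `|x| ^+ 2 = dotp x x }.

#[short(type="hilbertType")]
HB.structure Definition Hilbert (R : realType) :=
  {H of isHilbert R H & CompleteNormedModule R[i] H}.

Section LinearRelations.
Context (R : realType) (H : hilbertType R).
Implicit Types (A B S T : set (H * H)) (D K : set H).

Definition linear_relation A :=
  GRing.submod_closed [in A] /\ closed A.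

Definition rdom A : set H := [set f | exists f', A (f, f')].

Definition rmul A : set H := [set f' | A (0, f')].

Definition rinv A : set (H * H) := (A^-1)%relation.

Definition adjoint A : set (H * H) :=
  [set g | forall f, A f -> dotp f.2 g.1 = dotp f.1 g.2].

(* The order of R[i] is partial: 0 <= z says that z is real and nonnegative. *)
Definition nonnegative A := forall f, A f -> 0 <= dotp f.2 f.1.

Definition nonneg_selfadjoint A :=
  [/\ linear_relation A, A = adjoint A & nonnegative A].

Definition orthocompl D : set H := [set x | forall y, D y -> dotp x y = 0].

(* Operators are identified with their graphs, that is, with the relations S
   such that rmul S = [set 0]; [rapply S f] is then the value of S at f in
   rdom S. *)
Definition rapply S (f : H) : H := get [set f' | S (f, f')].

(* The graph of the operator part A_o, an operator in the Hilbert space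
   orthocompl (rmul A): the orthogonal complement of {0} x rmul A in A. *)
Definition op_part A : set (H * H) := A `&` [set f | orthocompl (rmul A) f.2].

Definition nonneg_selfadjoint_operator_in K S :=
  [/\ linear_relation S /\ rmul S = [set 0], S `<=` K `*` K,
      S = adjoint S `&` (K `*` K) & nonnegative S].

(* The square root, in the closed subspace K, of a nonnegative selfadjoint
   operator T in K. *)
Definition sqrt_op K T : set (H * H) :=
  get [set S | nonneg_selfadjoint_operator_in K S /\ (S \; S)%relation = T].

Definition sqrt_op_part A : set (H * H) :=
  sqrt_op (orthocompl (rmul A)) (op_part A).

Definition rel_form_dom A : set H := rdom (sqrt_op_part A).

(* Only meaningful on rel_form_dom A. *)
Definition rel_form A (phi : H) : R[i] := `|rapply (sqrt_op_part A) phi| ^+ 2.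

(* The nonnegative selfadjoint relation associated with the closed nonnegative
   form t of domain D, under the bijection
   C |-> (rel_form_dom C, rel_form C). *)
Definition rel_of_form D (t : H -> R[i]) : set (H * H) :=
  get [set C | [/\ nonneg_selfadjoint C, rel_form_dom C = D &
                   forall phi, D phi -> rel_form C phi = t phi]].

Definition form_sum A B : set (H * H) :=
  rel_of_form (rel_form_dom A `&` rel_form_dom B)
    (fun phi => rel_form A phi + rel_form B phi).

Definition parallel_sum A B : set (H * H) := rinv (form_sum (rinv A) (rinv B)).

Definition rel_le A B :=
  rel_form_dom B `<=` rel_form_dom A /\
  forall phi, rel_form_dom B phi -> rel_form A phi <= rel_form B phi.

Definition resolvent A (h : H) : H :=
  rapply (rinv [set (f.1, f.2 + f.1) | f in A]) h.

Definition strong_resolvent_cvg (A_ : nat -> set (H * H)) A :=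
  forall h : H, resolvent (A_ n) h @[n --> \oo] --> resolvent A h.

Definition nondecreasing_rel (A_ : nat -> set (H * H)) :=
  forall m n, (m <= n)%N -> rel_le (A_ m) (A_ n).

Definition nonincreasing_rel (A_ : nat -> set (H * H)) :=
  forall m n, (m <= n)%N -> rel_le (A_ n) (A_ m).

End LinearRelations.

(* Main.v *)
(* A nonnegative selfadjoint relation A is the graph {(J h, h - J h)} of its
   resolvent J, and its closed form a is tied to J by duality: phi lies in the form
   domain with a[phi] + |phi|^2 <= M iff 2 Re (h, phi) - (h, J h) <= M for all h.
   Hence the form order is the reverse order of the resolvents, and monotone strong
   resolvent convergence of A_n to A means that a is the increasing limit of the a_n.
   Such limits add up, which yields the form of the sum of the limits; conversely,
   when forms increase to a closed form, the points J_n h, minimizers of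
   c_n[phi] + |phi - h|^2, are Cauchy by the parallelogram law and their limit
   minimizes the limit functional. Part (ii) follows as J_(A^-1) = 1 - J_A.

   All estimates use the real inner product ip = Re dotp. *)
Require Import Defs.
From mathcomp Require Import all_boot all_order all_algebra.
From mathcomp Require Import complex.
From mathcomp Require Import all_classical all_reals all_analysis.
From mathcomp Require Import ring lra.
Import Order.TTheory GRing.Theory Num.Theory.
Import numFieldNormedType.Exports.
Set Implicit Arguments.
Unset Strict Implicit.
Unset Printing Implicit Defensive.
Local Open Scope classical_set_scope.
Local Open Scope complex_scope.
Local Open Scope ring_scope.

(** The form of a relation is defined through a square root picked by [get], and the form sum
    through another [get], so neither means anything until a witness is built. The unbounded root
    A_o^(1/2) is obtained from bounded operators only, as Q P^-1 for commuting roots P of J and Q of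
    1 - J. Duality then shows that the form depends on J alone, whichever root was picked.

    Domains vary with n and need not be dense, so pointwise limits of forms are awkward. Duality
    turns membership in a domain together with a bound on the form into a family of inequalities
    indexed by h, each of which passes to the limit.

    Weak compactness is replaced by [riesz_sequence]: near-maximizers of a concave quadratic
    functional are Cauchy. It yields the representation of a form, the recovery of a form from its
    resolvent, orthogonal projections and the surjectivity of A + 1. *)

Section RealAnalysis.
Context (R : realType).
Implicit Types (u v y : nat -> R) (a b : R).

(** The best t is d / P; if P = 0, a linear function of t bounded above forces d = 0. Both
    Cauchy-Schwarz inequalities and the optimality condition in [riesz_sequence] are instances. *)
Lemma discriminant_le (d e P : R) : 0 <= P ->
  (forall t : R, 2 * t * d - t ^+ 2 * P <= e) -> d ^+ 2 <= e * P.
Proof.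
move=> P0 h.
have e0 : 0 <= e by have := h 0; rewrite mulr0 mul0r expr0n /= mul0r subr0.
case: (ltgtP P 0) P0 h => // [Ppos _ h|-> _ h].
  have := h (d / P).
  have -> : 2 * (d / P) * d - (d / P) ^+ 2 * P = d ^+ 2 / P by field; rewrite gt_eqF.
  by rewrite ler_pdivrMr.
rewrite mulr0; suff -> : d = 0 by rewrite expr0n.
apply/eqP; apply: contraT => d0; exfalso.
(* This t would give e + 1 <= e. *)
have := h ((e + 1) / (2 * d)).
have -> : 2 * ((e + 1) / (2 * d)) * d = e + 1 by field.
lra.
Qed.

Lemma cvg_sqr_bound u a y :
  (forall n, (u n - a) ^+ 2 <= y n) -> y n @[n --> \oo] --> 0 ->
  u n @[n --> \oo] --> a.
Proof.
move=> h /cvgr0Pnorm_lt y0; apply/cvgrPdist_lt => e e0.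
have e2 : 0 < e ^+ 2 by rewrite exprn_gt0.
have := y0 _ e2; apply: filterS => n yn.
have := le_lt_trans (h n) (le_lt_trans (ler_norm _) yn).
by rewrite -(real_normK (num_real (u n - a))) ltr_pXn2r ?nnegrE ?(ltW e0)// distrC.
Qed.

Lemma cvg_sqr_bound_eq u a b y :
  (forall n, (a - u n) ^+ 2 <= y n) -> y n @[n --> \oo] --> 0 ->
  u n @[n --> \oo] --> b -> a = b.
Proof.
move=> h y0; apply: (cvg_unique (@Rhausdorff R)).
by apply: cvg_sqr_bound y0 => n; rewrite -sqrrN opprB.
Qed.

Lemma cvg_le_cst u a b : u n @[n --> \oo] --> a -> (forall n, u n <= b) -> a <= b.
Proof.
move=> ua h; rewrite -(cvg_lim (@Rhausdorff R) ua); apply: limr_le.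
  by apply/cvg_ex; exists a.
by apply: nearW.
Qed.

Lemma cvg_ge_cst u a b N :
  u n @[n --> \oo] --> a -> (forall n, (N <= n)%N -> b <= u n) -> b <= a.
Proof.
move=> ua h; rewrite -(cvg_lim (@Rhausdorff R) ua); apply: limr_ge.
  by apply/cvg_ex; exists a.
by exists N.
Qed.

Lemma nonincreasing_cvg_ge0 u : (forall n m, (n <= m)%N -> u m <= u n) ->
  (forall n, 0 <= u n) -> exists2 a, u n @[n --> \oo] --> a & forall n, a <= u n.
Proof.
move=> ndu u0.
have : cvgn u.
  apply: nonincreasing_is_cvgn; first by move=> n m; apply: ndu.
  by exists 0 => _ [n _ <-].
move=> /cvg_ex[a ua]; exists a => // n.
have := @cvg_ge_cst (fun k => - u k) (- a) (- u n) n.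
rewrite lerN2; apply; first exact: cvgN.
by move=> k nk; rewrite lerN2 ndu.
Qed.

Definition eps (n : nat) : R := n.+1%:R^-1.

Lemma eps_gt0 n : 0 < eps n. Proof. by rewrite invr_gt0 ltr0Sn. Qed.

Lemma eps_cvg (k : R) : k * eps n @[n --> \oo] --> 0.
Proof. by rewrite -(mulr0 k); apply: cvgM; [exact: cvg_cst|exact: cvg_harmonic]. Qed.

End RealAnalysis.

(** * Real inner product and sequential convergence *)

Section InnerProduct.
Context (R : realType) (H : hilbertType R).
Implicit Types x y z : H.

Definition ip x y : R := complex.Re (dotp x y).

Lemma ipDl x y z : ip (x + y) z = ip x z + ip y z.
Proof. by rewrite /ip linearDl raddfD. Qed.

Lemma ipDr x y z : ip z (x + y) = ip z x + ip z y.
Proof. by rewrite /ip linearDr raddfD. Qed.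

Lemma ipNl x z : ip (- x) z = - ip x z.
Proof. by rewrite /ip linearNl raddfN. Qed.

Lemma ipNr x z : ip z (- x) = - ip z x.
Proof. by rewrite /ip linearNr raddfN. Qed.

Lemma ipZl (r : R) x z : ip (r%:C *: x) z = r * ip x z.
Proof.
rewrite /ip linearZl_LR /=; case: (dotp x z) => a b /=.
by rewrite mul0r subr0.
Qed.

Lemma dotpC x y : dotp x y = (dotp y x)^*%C.
Proof. by rewrite hermC expr0 mul1r. Qed.

Lemma ipC x y : ip x y = ip y x.
Proof. by rewrite /ip dotpC; case: (dotp y x). Qed.

Lemma ipZr (r : R) x z : ip z (r%:C *: x) = r * ip z x.
Proof. by rewrite ipC ipZl ipC. Qed.

Lemma ip0l x : ip 0 x = 0. Proof. by rewrite /ip linear0l. Qed.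

Lemma ip0r x : ip x 0 = 0. Proof. by rewrite ipC ip0l. Qed.

Lemma ip_i x y : ip ('i%C *: x) ('i%C *: y) = ip x y.
Proof.
rewrite /ip linearZl_LR /= linearZr_LR /= -[Num.conj _]/(conjc _).
by case: (dotp x y) => a b /=; lra.
Qed.

Lemma ip_iC x y : ip ('i%C *: x) y = - ip x ('i%C *: y).
Proof. by rewrite -(ip_i x) scalerA -expr2 sqr_i scaleN1r ipNr opprK. Qed.

Lemma Im_dotp x y : complex.Im (dotp x y) = ip x ('i%C *: y).
Proof.
rewrite /ip linearZr_LR /= -[Num.conj _]/(conjc _).
by case: (dotp x y) => a b /=; lra.
Qed.

Lemma dotpE x y : dotp x y = (ip x y)%:C + 'i%C * (ip x ('i%C *: y))%:C.
Proof. by rewrite -Im_dotp [LHS]complexE. Qed.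

Lemma dotp_ip x : dotp x x = (ip x x)%:C.
Proof.
have := congr1 (@complex.Im R) (dotpC x x); rewrite /ip.
by case: (dotp x x) => a b /= h; congr (_ +i* _); lra.
Qed.

Lemma norm_ip x : `|x| ^+ 2 = (ip x x)%:C.
Proof. by rewrite norm_dotp dotp_ip. Qed.

Lemma ip_ge0 x : 0 <= ip x x.
Proof. by rewrite -ler0c -norm_ip exprn_ge0. Qed.

Lemma ip_eq0 x : ip x x = 0 -> x = 0.
Proof.
move=> h; have /eqP := norm_ip x.
by rewrite h expf_eq0 /= normr_eq0 => /eqP.
Qed.

Lemma ip_inj x y : (forall z, ip z x = ip z y) -> x = y.
Proof.
move=> h; apply/eqP; rewrite -subr_eq0; apply/eqP/ip_eq0.
by rewrite {1}ipDr ipNr !(h (x - y)) subrr.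
Qed.

Lemma scale_ReIm (c : R[i]) x :
  c *: x = (complex.Re c)%:C *: x + (complex.Im c)%:C *: ('i%C *: x).
Proof. by rewrite {1}[c]complexE scalerDl scalerA [_ * 'i%C]mulrC. Qed.

(** The imaginary part of [dotp x y] is [ip x (i y)], so on a set stable under i the real condition
    controls both parts. *)
Lemma dotp_eq0P x (D : set H) : (forall y, D y -> D ('i%C *: y)) ->
  (forall y, D y -> dotp x y = 0) <-> (forall y, D y -> ip x y = 0).
Proof.
move=> Di; split => h y Dy; first by rewrite /ip h.
by rewrite dotpE !h ?mulr0 ?addr0//; exact: Di.
Qed.

Definition ipE := (ipDl, ipDr, ipNl, ipNr, ipZl, ipZr, ip0l, ip0r).

Lemma cauchy_schwarz x y : ip x y ^+ 2 <= ip x x * ip y y.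
Proof.
apply: discriminant_le (ip_ge0 y) _ => t.
have := ip_ge0 (x + (- t)%:C *: y).
by rewrite !ipE (ipC y x); nra.
Qed.

(** Stated with real squared distances, since the norm of [H] takes values in [R[i]]. *)
Definition hcvg (u : nat -> H) (a : H) :=
  ip (u n - a) (u n - a) @[n --> \oo] --> 0.

Lemma hcvgP (u : nat -> H) a : hcvg u a <-> u n @[n --> \oo] --> a.
Proof.
split.
  move=> /cvgr0Pnorm_lt h; apply/cvgrPdist_lt => -[e e'].
  rewrite ltcE /= => /andP[/eqP -> e0].
  have e2 : 0 < e ^+ 2 by rewrite exprn_gt0.
  have := h _ e2; apply: filterS => n hn.
  rewrite distrC -(@ltr_pXn2r _ 2) ?nnegrE ?lecR ?(ltW e0)// norm_ip.
  rewrite -[e +i* 0]/(e%:C) -rmorphXn /= ltcR.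
  exact: le_lt_trans (ler_norm _) hn.
move=> /cvgrPdist_lt h; apply/cvgr0Pnorm_lt => e e0.
have s0 : 0 < (Num.sqrt e)%:C by rewrite ltcR sqrtr_gt0.
have := h _ s0; apply: filterS => n hn.
rewrite ger0_norm ?ip_ge0// -ltcR -norm_ip -(sqr_sqrtr (ltW e0)) rmorphXn /=.
by rewrite ltr_pXn2r ?nnegrE ?(ltW s0)// distrC.
Qed.

Lemma hcvg_ip u a z : hcvg u a -> ip (u n) z @[n --> \oo] --> ip a z.
Proof.
move=> ua; apply: (@cvg_sqr_bound _ _ _ (fun n => ip (u n - a) (u n - a) * ip z z)).
  by move=> n; have := cauchy_schwarz (u n - a) z; rewrite {1}ipDl ipNl.
by rewrite -(mul0r (ip z z)); apply: cvgM => //; exact: cvg_cst.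
Qed.

Lemma hcvg_unique u a b : hcvg u a -> hcvg u b -> a = b.
Proof.
move=> ua ub; apply: ip_inj => z; rewrite !(ipC z).
have h1 := hcvg_ip (z:=z) ua; have h2 := hcvg_ip (z:=z) ub.
exact: (cvg_unique (@Rhausdorff R) h1 h2).
Qed.

Lemma hcvg_le u a (y : nat -> R) : (forall n, ip (u n - a) (u n - a) <= y n) ->
  y n @[n --> \oo] --> 0 -> hcvg u a.
Proof.
move=> h y0; apply: (squeeze_cvgr _ (cvg_cst 0) y0).
by apply: nearW => n; rewrite ip_ge0 h.
Qed.

Lemma hcvg_lin (f : H -> H) u a : {morph f : x y / x - y} ->
  (forall x, ip (f x) (f x) <= ip x x) -> hcvg u a -> hcvg (f \o u) (f a).
Proof. by move=> fB fle; apply: hcvg_le => n /=; rewrite -fB. Qed.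

Lemma hcvgD u v a b : hcvg u a -> hcvg v b -> hcvg (fun n => u n + v n) (a + b).
Proof. by move=> /hcvgP ua /hcvgP vb; apply/hcvgP; exact: cvgD. Qed.

Lemma hcvg_cst a : hcvg (fun=> a) a.
Proof. by apply/hcvgP; exact: cvg_cst. Qed.

(** The bound [y n + y m] is the shape that midpoint arguments such as the one in [riesz_sequence]
    produce. *)
Lemma hcvg_cauchy u (y : nat -> R) :
  (forall n m, ip (u n - u m) (u n - u m) <= y n + y m) ->
  y n @[n --> \oo] --> 0 -> exists a, hcvg u a.
Proof.
move=> h y0; suff /cauchy_cvgP/cvg_ex[a ua] : cauchy (u n @[n --> \oo]).
  by exists a; apply/hcvgP.
apply/cauchy_ballP => -[e e'].
rewrite ltcE /= => /andP[/eqP -> e0].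
have e2 : 0 < e ^+ 2 / 2 by rewrite divr_gt0// exprn_gt0.
move/cvgr0Pnorm_lt/(_ _ e2): y0 => [N _ hN].
exists ([set u n | n in [set n | (N <= n)%N]], [set u n | n in [set n | (N <= n)%N]]).
  by split; exists N => // n /= Nn; exists n.
move=> _ [[n /= Nn <-] [m /= Nm <-]] /=.
rewrite -ball_normE /= -(@ltr_pXn2r _ 2) ?nnegrE ?lecR ?(ltW e0)// norm_ip.
rewrite -[e +i* 0]/(e%:C) -rmorphXn /= ltcR.
apply: le_lt_trans (h _ _) _.
have := hN _ Nn; have := hN _ Nm.
have := ler_norm (y n); have := ler_norm (y m); lra.
Qed.

Lemma closed_seqP (A : set (H * H)) : closed A <->
  forall u v a b, (forall n, A (u n, v n)) -> hcvg u a -> hcvg v b -> A (a, b).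
Proof.
split.
  move=> cA u v a b Auv /hcvgP ua /hcvgP vb.
  by apply: (closed_cvg A cA _ (a, b) (cvg_pair ua vb)); exact: nearW.
move=> h [a b] ab.
have e0 n : 0 < (eps R n)%:C by rewrite ltcR eps_gt0.
have ex n : exists f : H * H, A f /\ (ball a (eps R n)%:C `*` ball b (eps R n)%:C) f.
  have [|f [Af fB]] := ab (ball a (eps R n)%:C `*` ball b (eps R n)%:C).
    by exists (ball a (eps R n)%:C, ball b (eps R n)%:C) => //; split; apply: nbhsx_ballx.
  by exists f.
have [f hf] := choice ex.
(* The squared distance is at most the squared radius, hence at most [eps R n]; the factor 1 matches
   [eps_cvg]. *)
have bd x z n : ball x (eps R n)%:C z -> ip (z - x) (z - x) <= 1 * eps R n.
  rewrite -ball_normE /= -(@ltr_pXn2r _ 2) ?nnegrE ?lecR ?(ltW (eps_gt0 _ _))//.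
  rewrite distrC norm_ip -rmorphXn /= ltcR => /ltW /le_trans; apply.
  rewrite mul1r expr2 ler_piMr ?(ltW (eps_gt0 _ _))//.
  by rewrite invf_le1 ?ler1n.
apply: (h (fst \o f) (snd \o f)).
- by move=> n /=; have [] := hf n; case: (f n).
- by apply: hcvg_le (eps_cvg 1) => n; apply: bd; have [_ []] := hf n.
- by apply: hcvg_le (eps_cvg 1) => n; apply: bd; have [_ []] := hf n.
Qed.

End InnerProduct.

(** * Positive semidefinite real forms on complex subspaces *)

Section RealForms.
Context (R : realType) (V : lmodType R[i]).

Record csubspace (D : set V) : Prop := CSubspace {
  csubspace0 : D 0;
  csubspaceP : forall c x y, D x -> D y -> D (c *: x + y) }.

(** Only real bilinearity, since [p] is the real part of a sesquilinear form. It may be degenerate,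
    like [ip h (J k)] when J has a kernel; [V] will be [H] or [H * H]. *)
Record semi_inner (D : set V) (p : V -> V -> R) : Prop := SemiInner {
  semi_innerPl : forall r x y z, D x -> D y -> D z ->
    p (r%:C *: x + y) z = r * p x z + p y z;
  semi_innerC : forall x y, D x -> D y -> p x y = p y x;
  semi_inner_ge0 : forall x, D x -> 0 <= p x x }.

Context (D : set V) (p : V -> V -> R).
Hypotheses (subD : csubspace D) (pP : semi_inner D p).

Lemma csubspaceB x y : D x -> D y -> D (x - y).
Proof. by move=> Dx Dy; rewrite addrC -scaleN1r; apply: (csubspaceP subD). Qed.

Lemma csubspaceZ c x : D x -> D (c *: x).
Proof.
by move=> Dx; rewrite -[_ *: _]addr0; apply: (csubspaceP subD) (csubspace0 subD).
Qed.

Lemma csubspaceD x y : D x -> D y -> D (x + y).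
Proof. by move=> Dx Dy; rewrite -[x]scale1r; apply: (csubspaceP subD). Qed.

Lemma semi_inner_sqr r x y : D x -> D y ->
  p (r%:C *: x + y) (r%:C *: x + y) = r ^+ 2 * p x x + 2 * r * p x y + p y y.
Proof.
move=> Dx Dy; have Dxy := csubspaceP subD r%:C Dx Dy.
rewrite (semi_innerPl pP)// !(semi_innerC pP _ Dxy)// !(semi_innerPl pP)//.
by rewrite (semi_innerC pP Dy Dx); ring.
Qed.

Lemma semi_innerZl r x y : D x -> D y -> p (r%:C *: x) y = r * p x y.
Proof.
move=> Dx Dy; have D0 := csubspace0 subD.
have := semi_innerPl pP 1 D0 D0 Dy; rewrite scaler0 addr0 => h0.
by have := semi_innerPl pP r Dx D0 Dy; rewrite addr0 => ->; lra.
Qed.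

Lemma semi_innerDl x y z : D x -> D y -> D z -> p (x + y) z = p x z + p y z.
Proof.
move=> Dx Dy Dz; have := semi_innerPl pP 1 Dx Dy Dz.
by rewrite scale1r mul1r.
Qed.

Lemma semi_innerBl x y z : D x -> D y -> D z -> p (x - y) z = p x z - p y z.
Proof.
move=> Dx Dy Dz; have := semi_innerPl pP (-1) Dy Dx Dz.
rewrite rmorphN1 scaleN1r addrC => ->; ring.
Qed.

Lemma semi_inner0 x : D x -> p x 0 = 0.
Proof.
move=> Dx; have D0 := csubspace0 subD; rewrite (semi_innerC pP)//.
by have := semi_innerZl 0 Dx Dx; rewrite scale0r mul0r.
Qed.

Lemma semi_inner_sqrB x y : D x -> D y ->
  p (x - y) (x - y) = p x x - 2 * p x y + p y y.
Proof.
move=> Dx Dy; have := semi_inner_sqr (-1) Dy Dx.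
rewrite rmorphN1 scaleN1r addrC => ->; rewrite (semi_innerC pP Dy Dx); ring.
Qed.

Lemma semi_inner_cauchy_schwarz x y : D x -> D y -> p x y ^+ 2 <= p x x * p y y.
Proof.
move=> Dx Dy; apply: discriminant_le (semi_inner_ge0 pP Dy) _ => t.
have := semi_inner_ge0 pP (csubspaceP subD (- t)%:C Dy Dx).
by rewrite semi_inner_sqr// (semi_innerC pP Dy Dx); lra.
Qed.

Lemma semi_inner_cvg (u : nat -> V) a w : (forall n, D (u n)) -> D a -> D w ->
  p (u n - a) (u n - a) @[n --> \oo] --> 0 -> p (u n) w @[n --> \oo] --> p a w.
Proof.
move=> Du Da Dw ua.
apply: (@cvg_sqr_bound _ _ _ (fun n => p (u n - a) (u n - a) * p w w)).
  move=> n; rewrite -semi_innerBl//; apply: semi_inner_cauchy_schwarz => //.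
  exact: csubspaceB.
by rewrite -(mul0r (p w w)); apply: cvgM => //; exact: cvg_cst.
Qed.

(* A Riesz representation of [l] by a [p]-Cauchy sequence, obtained by maximizing
   [2 l v - p v v] and perturbing near-maximizers in the direction [w]. *)
Lemma riesz_sequence (l : V -> R) M :
  (forall r x y, D x -> D y -> l (r%:C *: x + y) = r * l x + l y) ->
  (forall v, D v -> 2 * l v - p v v <= M) ->
  exists v : nat -> V, [/\ forall n, D (v n),
    forall n m, p (v n - v m) (v n - v m) <= 2 * eps R n + 2 * eps R m &
    forall n w, D w -> (l w - p (v n) w) ^+ 2 <= eps R n * p w w].
Proof.
move=> lP lM; pose F v := 2 * l v - p v v.
have supE : has_sup (F @` D).
  split; first by exists (F 0), 0 => //; exact: (csubspace0 subD).
  by exists M => _ [v Dv <-]; exact: lM.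
pose s := sup (F @` D).
have Fs v : D v -> F v <= s.
  by move=> Dv; apply: sup_upper_bound => //; exists v.
have ex n : exists v, D v /\ s - eps R n < F v.
  by have [_ [v Dv <-] ?] := sup_adherent (eps_gt0 R n) supE; exists v.
have [v vP] := choice ex.
exists v; split=> [n|n m|n w Dw]; first by have [] := vP n.
- have [Dn sn] := vP n; have [Dm sm] := vP m.
  have Dnm := csubspaceP subD 1%:C Dn Dm.
  (* At the midpoint, F exceeds the mean of F (v n) and F (v m) by a quarter of p (v n - v m) (v n -
     v m), yet stays below s. *)
  have := Fs _ (csubspaceP subD 2^-1%:C Dnm (csubspace0 subD)).
  have D0 := csubspace0 subD.
  rewrite semi_inner_sqrB// /F !semi_inner_sqr// !semi_inner0//.
  have -> : l (2^-1%:C *: (1%:C *: v n + v m) + 0) = 2^-1 * (l (v n) + l (v m)).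
    have := lP 1 _ _ D0 D0; rewrite scaler0 addr0 => l0.
    by rewrite !lP//; lra.
  move: sn sm; rewrite /F; lra.
- have [Dn sn] := vP n; apply: discriminant_le (semi_inner_ge0 pP Dw) _ => t.
  (* F (t w + v n) <= s < F (v n) + eps n for every real t. *)
  have := Fs _ (csubspaceP subD t%:C Dw Dn).
  rewrite /F semi_inner_sqr// lP// (semi_innerC pP Dw Dn).
  move: sn; rewrite /F; lra.
Qed.

End RealForms.

(** * Closed forms, their resolvents and duality *)

Section ClosedForms.
Context (R : realType) (H : hilbertType R).
Implicit Types (D : set H) (p : H -> H -> R) (J : H -> H).

(* [p] stands for [t + ip] with [t] a closed nonnegative form of domain [D]; a form
   is encoded by its real part, which determines it. *)
Record closed_form D p : Prop := ClosedForm {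
  closed_form_sub : csubspace D;
  closed_form_inner : semi_inner D p;
  closed_form_ge : forall x, D x -> ip x x <= p x x;
  closed_form_i : forall x y, D x -> D y -> p ('i%C *: x) ('i%C *: y) = p x y;
  closed_form_complete : forall (v : nat -> H) y, (forall n, D (v n)) ->
    (forall n m, p (v n - v m) (v n - v m) <= y n + y m) ->
    y n @[n --> \oo] --> 0 ->
    exists2 a, D a & p (v n - a) (v n - a) @[n --> \oo] --> 0 }.

(** The weak form of (C + 1) J h = h, where C is the relation of the unshifted form. *)
Definition represents J D p :=
  forall h, D (J h) /\ forall x, D x -> p (J h) x = ip h x.

(** For a symmetric J the last condition, J^2 <= J, amounts to 0 <= J <= 1. The kernel of J may be
    nonzero: it is the multivalued part of the relation. *)
Record resolvent_like J : Prop := ResolventLike {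
  resolvent_likeP : forall c x y, J (c *: x + y) = c *: J x + J y;
  resolvent_likeC : forall x y, ip (J x) y = ip x (J y);
  resolvent_like_le : forall x, ip (J x) (J x) <= ip x (J x) }.

Section Representation.
Context D p (Dp : closed_form D p).
Let subD := closed_form_sub Dp.
Let pP := closed_form_inner Dp.

Lemma exists_represents : exists J, represents J D p.
Proof.
suff ex h : exists a, D a /\ forall x, D x -> p a x = ip h x.
  by have [J JP] := choice ex; exists J.
have [||v [Dv vC vl]] := riesz_sequence subD pP (l := ip h) (M := ip h h).
- by move=> r x y _ _; rewrite !ipE.
(* 2 (h, v) - p(v, v) <= 2 (h, v) - |v|^2 <= |h|^2. *)
- move=> v Dv; have := closed_form_ge Dp Dv; have := ip_ge0 (h - v).
  by rewrite !ipE (ipC v h); lra.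
have [a Da va] := closed_form_complete Dp Dv vC (eps_cvg 2).
exists a; split => // x Dx.
apply/esym; apply: (@cvg_sqr_bound_eq _ (fun n => p (v n) x) _ _
  (fun n => p x x * eps R n)).
- by move=> n; rewrite [p x x * _]mulrC; exact: vl.
- exact: eps_cvg.
- exact: (semi_inner_cvg subD pP).
Qed.

Context J (rJ : represents J D p).

Lemma representsD h : D (J h). Proof. by have [] := rJ h. Qed.

Lemma representsE h x : D x -> p (J h) x = ip h x.
Proof. by have [_] := rJ h; apply. Qed.

Lemma represents_uniq x h : D x -> (forall y, D y -> p x y = ip h y) -> x = J h.
Proof.
move=> Dx xh; apply/eqP; rewrite -subr_eq0; apply/eqP/ip_eq0/le_anti.
rewrite ip_ge0 andbT; have DB := csubspaceB subD Dx (representsD h).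
apply: le_trans (closed_form_ge Dp DB) _.
rewrite (semi_innerBl pP)//; last exact: representsD.
by rewrite xh// representsE// subrr.
Qed.

Lemma represents_C x y : ip (J x) y = ip x (J y).
Proof.
have Jx := representsD x; have Jy := representsD y.
by rewrite ipC -(representsE y Jx) -(representsE x Jy) (semi_innerC pP).
Qed.

Lemma closed_form_iC x y : D x -> D y -> p ('i%C *: x) y = - p x ('i%C *: y).
Proof.
move=> Dx Dy; have Di z : D z -> D ('i%C *: z) by exact: (csubspaceZ subD).
have := closed_form_i Dp Dx (Di _ Dy).
have -> : 'i%C *: ('i%C *: y) = (-1)%:C *: y.
  by rewrite scalerA -expr2 sqr_i rmorphN1.
rewrite (semi_innerC pP (Di _ Dx) (csubspaceZ subD _ Dy)).
rewrite (semi_innerZl subD pP _ Dy (Di _ Dx)).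
by rewrite (semi_innerC pP Dy (Di _ Dx)) => <-; ring.
Qed.

(** Complex linearity is recovered from a real form: split c into real and imaginary parts, and use
    that multiplication by i is skew for both [p] and [ip]. *)
Lemma represents_resolvent_like : resolvent_like J.
Proof.
split; [|exact: represents_C|]; last first.
  move=> h; rewrite -(representsE h (representsD h)).
  exact: closed_form_ge (representsD h).
move=> c x y; apply/esym/represents_uniq.
  by apply: (csubspaceP subD); exact: representsD.
move=> z Dz; have Di w : D w -> D ('i%C *: w) by exact: (csubspaceZ subD).
have Jx := representsD x; have Jy := representsD y.
rewrite (semi_innerDl pP)//; last exact: (csubspaceZ subD).
rewrite [c *: J x]scale_ReIm (semi_innerPl pP)//; last exact/(csubspaceZ subD)/Di.
rewrite (semi_innerZl subD pP)//; last exact: Di.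
rewrite closed_form_iC// !representsE//; last exact: Di.
by rewrite ipDl (scale_ReIm c x) !ipE ip_iC.
Qed.

(** Expand p(J h - x, J h - x) >= 0; equality holds at x = J h. *)
Lemma represents_dual_le x h : D x -> 2 * ip h x - ip h (J h) <= p x x.
Proof.
move=> Dx; have Jh := representsD h.
have := semi_inner_ge0 pP (csubspaceB subD Jh Dx).
by rewrite (semi_inner_sqrB subD pP)// !representsE//; lra.
Qed.

(* The supremum over [h] is the convex biconjugate of [p]; along a maximizing
   sequence [h], the vectors [J h] converge to [x] in form norm. *)
Lemma represents_dual_ge x M : (forall h, 2 * ip h x - ip h (J h) <= M) ->
  D x /\ p x x <= M.
Proof.
(* q is [p] pulled back along J, since (h, J k) = p(J h, J k). *)
move=> hM; pose q h k := ip h (J k).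
have JP := represents_resolvent_like.
have JB a b : J (a - b) = J a - J b.
  by rewrite addrC -scaleN1r (resolvent_likeP JP) scaleN1r addrC.
have qP : semi_inner setT q.
  split=> [r a b c _ _ _|a b _ _|a _]; rewrite /q.
  - by rewrite !ipE.
  - by rewrite -represents_C ipC.
  - exact: le_trans (ip_ge0 _) (resolvent_like_le JP a).
have sT : csubspace (setT : set H) by [].
have [||v [_ vC vl]] := riesz_sequence sT qP (l := fun h => ip h x) (M := M).
- by move=> r a b _ _; rewrite !ipE.
- by move=> h _; exact: hM.
have DJ n : D (J (v n)) by exact: representsD.
have [|a Da va] := closed_form_complete Dp DJ _ (eps_cvg 2).
  by move=> n m; rewrite -JB representsE; [exact: vC|exact: representsD].
(* Optimality reads ((h, x) - p(J h, J v_n))^2 <= eps_n q(h, h), and the form value tends to p(J h,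
   a) = (h, a). *)
have xa : x = a.
  apply: ip_inj => h; rewrite -(representsE h Da).
  apply: (@cvg_sqr_bound_eq _ (fun n => p (J h) (J (v n))) _ _
    (fun n => q h h * eps R n)).
  - move=> n; rewrite [q h h * _]mulrC representsE//.
    by have := vl n h I; rewrite /q -represents_C (ipC (J _)) .
  - exact: eps_cvg.
  - have Jh := representsD h.
    have := semi_inner_cvg subD pP DJ Da Jh va.
    by rewrite (semi_innerC pP Da Jh); under eq_fun do rewrite (semi_innerC pP (DJ _) Jh).
rewrite {1}xa; split => //.
(* 2 (v_n, x) - (v_n, J v_n) equals p(x, x) - p(J v_n - x, J v_n - x), which tends to p(x, x). *)
have h0 : (p x x - p (J (v n) - a) (J (v n) - a)) @[n --> \oo] --> p x x - 0.
  by apply: cvgB => //; exact: cvg_cst.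
rewrite -[p x x]subr0; apply: cvg_le_cst h0 _ => n.
apply: le_trans (hM (v n)).
rewrite -xa (semi_inner_sqrB subD pP) ?xa// -?xa.
by rewrite !representsE ?xa//; lra.
Qed.

End Representation.
End ClosedForms.

(** * Square roots of bounded positive operators by iteration *)

Section SquareRoot.
Context (R : realType) (H : hilbertType R).
Implicit Types (T B J P : H -> H).

Definition nrm (x : H) : R := complex.Re `|x|.

Lemma nrmE x : `|x| = (nrm x)%:C.
Proof. by rewrite /nrm RRe_real// normr_real. Qed.

Lemma nrm_ge0 x : 0 <= nrm x.
Proof. by rewrite -ler0c -nrmE. Qed.

Lemma nrm_sqr x : nrm x ^+ 2 = ip x x.
Proof. by apply: (@complexI R); rewrite rmorphXn /= -nrmE norm_ip. Qed.

Lemma nrmD x y : nrm (x + y) <= nrm x + nrm y.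
Proof. by rewrite -lecR rmorphD /= -!nrmE ler_normD. Qed.

Lemma nrmZ (r : R) x : 0 <= r -> nrm (r%:C *: x) = r * nrm x.
Proof.
move=> r0; apply: (@complexI R); rewrite rmorphM /= -!nrmE normrZ.
by rewrite ger0_norm// ler0c.
Qed.

Lemma nrm_le x y (k : R) : 0 <= k -> nrm x <= k * nrm y -> ip x x <= k ^+ 2 * ip y y.
Proof.
move=> k0 h; rewrite -!nrm_sqr -exprMn ler_pXn2r ?nnegrE ?nrm_ge0//.
by rewrite mulr_ge0// nrm_ge0.
Qed.

Lemma hcvg_nrm (u : nat -> H) a : hcvg u a -> nrm (u n) @[n --> \oo] --> nrm a.
Proof.
move=> ua; apply: cvg_sqr_bound ua => n; rewrite -nrm_sqr.
have h1 := nrmD (u n - a) a; have h2 := nrmD (a - u n) (u n).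
have h3 : nrm (a - u n) = nrm (u n - a) by rewrite /nrm distrC.
rewrite !subrK h3 in h1 h2.
have := nrm_ge0 (u n - a); nra.
Qed.

Definition linear_map T := forall c x y, T (c *: x + y) = c *: T x + T y.

Lemma linear_mapD T : linear_map T -> {morph T : x y / x + y}.
Proof. by move=> Tl x y; have := Tl 1 x y; rewrite !scale1r. Qed.

Lemma linear_mapB T : linear_map T -> {morph T : x y / x - y}.
Proof. by move=> Tl x y; rewrite addrC -scaleN1r Tl scaleN1r addrC. Qed.

Lemma linear_map0 T : linear_map T -> T 0 = 0.
Proof. by move=> Tl; have := linear_mapB Tl 0 0; rewrite !subrr. Qed.

Lemma linear_mapZ T : linear_map T -> forall c x, T (c *: x) = c *: T x.
Proof. by move=> Tl c x; have := Tl c x 0; rewrite (linear_map0 Tl) !addr0. Qed.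

Lemma linear_map_sub T : linear_map T -> linear_map (fun x => x - T x).
Proof. by move=> Tl c x y; rewrite Tl opprD scalerBr addrACA. Qed.

Record sym_contraction T : Prop := SymContraction {
  sym_contraction_linear : linear_map T;
  sym_contractionC : forall x y, ip (T x) y = ip x (T y);
  sym_contraction_le : forall x, ip (T x) (T x) <= ip x x }.

Lemma sym_contraction_hcvg T u a : sym_contraction T -> hcvg u a -> hcvg (T \o u) (T a).
Proof.
move=> cT; apply: hcvg_lin (linear_mapB (sym_contraction_linear cT)) _.
exact: sym_contraction_le.
Qed.

Lemma sym_contraction_nrm T x : sym_contraction T -> nrm (T x) <= nrm x.
Proof.
move=> cT; rewrite -(@ler_pXn2r _ 2) ?nnegrE ?nrm_ge0// !nrm_sqr.
exact: sym_contraction_le.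
Qed.

Section Iteration.
Context B (cB : sym_contraction B).
Let lB := sym_contraction_linear cB.

Fixpoint sqrt_iter n (x : H) : H :=
  if n is n'.+1 then 2^-1%:C *: (B x + sqrt_iter n' (sqrt_iter n' x)) else 0.

(** The same recursion with B = 1: a majorant for the norms of the iterates and of their
    differences. *)
Fixpoint scalar_iter n : R :=
  if n is n'.+1 then (1 + scalar_iter n' ^+ 2) / 2 else 0.

Lemma scalar_iter_bound n : 0 <= scalar_iter n <= 1.
Proof. by elim: n => [|n /andP[h0 h1]] /=; apply/andP; split; nra. Qed.

Lemma scalar_iter_le n m : (n <= m)%N -> scalar_iter n <= scalar_iter m.
Proof.
have incr k : scalar_iter k <= scalar_iter k.+1.
  rewrite /=; have := sqr_ge0 (1 - scalar_iter k); nra.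
by move=> /subnK <-; elim: (m - n)%N => // k IH; exact: le_trans IH (incr _).
Qed.

Lemma sqrt_iter_linear n : linear_map (sqrt_iter n).
Proof.
elim: n => [|n IH] c x y /=; first by rewrite scaler0 addr0.
by rewrite !IH lB !scalerDr !scalerA [c * _]mulrC addrACA.
Qed.

Lemma sqrt_iterC n x y : ip (sqrt_iter n x) y = ip x (sqrt_iter n y).
Proof.
elim: n x y => [|n IH] x y /=; first by rewrite !ipE.
by rewrite !ipE (sym_contractionC cB) !IH.
Qed.

Lemma sqrt_iter_nrm n x : nrm (sqrt_iter n x) <= scalar_iter n * nrm x.
Proof.
elim: n x => [|n IH] x /=; first by rewrite mul0r /nrm normr0.
have [s0 s1] := andP (scalar_iter_bound n).
rewrite nrmZ ?invr_ge0//; apply: le_trans (ler_wpM2l _ (nrmD _ _)) _; first by lra.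
have := sym_contraction_nrm x cB.
have := le_trans (IH (sqrt_iter n x)) (ler_wpM2l s0 (IH x)); nra.
Qed.

(** With D = X_(n+1) - X_n, the next increment is (X_(n+1) D + D X_n) / 2. The scalar increments
    obey the same identity exactly, so the bound propagates. *)
Lemma sqrt_iterS_nrm n x : nrm (sqrt_iter n.+1 x - sqrt_iter n x)
  <= (scalar_iter n.+1 - scalar_iter n) * nrm x.
Proof.
elim: n x => [|n IH] x.
  rewrite [sqrt_iter 0 x]/= [scalar_iter 0]/= !subr0.
  exact: sqrt_iter_nrm.
have -> : sqrt_iter n.+2 x - sqrt_iter n.+1 x = 2^-1%:C *:
    (sqrt_iter n.+1 (sqrt_iter n.+1 x - sqrt_iter n x)
     + (sqrt_iter n.+1 (sqrt_iter n x) - sqrt_iter n (sqrt_iter n x))).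
  rewrite (linear_mapB (sqrt_iter_linear n.+1)) addrA subrK.
  rewrite [sqrt_iter n.+2 x]/= [X in _ - X = _]/= -scalerBr.
  by rewrite opprD addrACA subrr add0r.
rewrite nrmZ ?invr_ge0//.
have [s0 s1] := andP (scalar_iter_bound n).
have [t0 t1] := andP (scalar_iter_bound n.+1).
have h1 := le_trans (sqrt_iter_nrm n.+1 (sqrt_iter n.+1 x - sqrt_iter n x))
  (ler_wpM2l t0 (IH x)).
have d0 : 0 <= scalar_iter n.+1 - scalar_iter n by rewrite subr_ge0 scalar_iter_le.
have h2 := le_trans (IH (sqrt_iter n x)) (ler_wpM2l d0 (sqrt_iter_nrm n x)).
have h3 := nrmD (sqrt_iter n.+1 (sqrt_iter n.+1 x - sqrt_iter n x))
  (sqrt_iter n.+1 (sqrt_iter n x) - sqrt_iter n (sqrt_iter n x)).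
have -> : scalar_iter n.+2 - scalar_iter n.+1 =
  2^-1 * (scalar_iter n.+1 * (scalar_iter n.+1 - scalar_iter n)
          + (scalar_iter n.+1 - scalar_iter n) * scalar_iter n).
  have E k : scalar_iter k.+1 = (1 + scalar_iter k ^+ 2) / 2 by [].
  by rewrite (E n.+1); move: (E n); lra.
rewrite -mulrA ler_wpM2l//; lra.
Qed.

Lemma sqrt_iter_dist n m x : (n <= m)%N -> nrm (sqrt_iter m x - sqrt_iter n x)
  <= (scalar_iter m - scalar_iter n) * nrm x.
Proof.
move=> /subnK <-; elim: (m - n)%N => [|k IH].
  by rewrite !subrr mul0r /nrm normr0.
rewrite addSn.
have := nrmD (sqrt_iter (k + n).+1 x - sqrt_iter (k + n) x)
  (sqrt_iter (k + n) x - sqrt_iter n x).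
have := sqrt_iterS_nrm (k + n) x; rewrite addrA subrK; lra.
Qed.

Lemma sqrt_iter_cvg x : exists a, hcvg (fun n => sqrt_iter n x) a.
Proof.
have [||a ua au] := @nonincreasing_cvg_ge0 R (fun n => 1 - scalar_iter n).
- by move=> n m nm; rewrite lerD2l lerN2 scalar_iter_le.
- by move=> n; rewrite subr_ge0; have /andP[] := scalar_iter_bound n.
apply: (@hcvg_cauchy _ _ _ (fun n => (1 - scalar_iter n - a) * ip x x)); last first.
  rewrite -(mul0r (ip x x)) -(subrr a).
  by apply: cvgM; [apply: cvgB => //; exact: cvg_cst|exact: cvg_cst].
have wlg n m : (n <= m)%N ->
    ip (sqrt_iter m x - sqrt_iter n x) (sqrt_iter m x - sqrt_iter n x)
    <= (1 - scalar_iter n - a) * ip x x + (1 - scalar_iter m - a) * ip x x.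
  move=> nm; have d0 : 0 <= scalar_iter m - scalar_iter n.
    by rewrite subr_ge0 scalar_iter_le.
  (* Here d = s_m - s_n lies in [0, 1], so d^2 <= d <= 1 - s_n - a, because a <= 1 - s_m. *)
  apply: le_trans (nrm_le d0 (sqrt_iter_dist x nm)) _.
  rewrite -mulrDl ler_wpM2r ?ip_ge0//.
  have := au n; have := au m.
  have /andP[] := scalar_iter_bound n; have /andP[] := scalar_iter_bound m; nra.
move=> n m; case: (leqP m n) => [mn|/ltnW nm]; first by rewrite [leRHS]addrC; exact: wlg.
by rewrite -opprB ipNl ipNr opprK; exact: wlg.
Qed.

Definition sqrt_lim x := projT1 (cid (sqrt_iter_cvg x)).

Lemma sqrt_lim_cvg x : hcvg (fun n => sqrt_iter n x) (sqrt_lim x).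
Proof. exact: projT2 (cid (sqrt_iter_cvg x)). Qed.

Lemma sqrt_lim_linear : linear_map sqrt_lim.
Proof.
move=> c x y; apply: hcvg_unique (sqrt_lim_cvg _) _.
under eq_fun do rewrite sqrt_iter_linear.
apply: hcvgD (sqrt_lim_cvg y); apply/hcvgP; apply: cvgZr.
exact/hcvgP/sqrt_lim_cvg.
Qed.

Lemma sqrt_lim_contraction : sym_contraction sqrt_lim.
Proof.
split; first exact: sqrt_lim_linear.
- move=> x y.
  have h1 := hcvg_ip (z := y) (sqrt_lim_cvg x).
  have h2 := hcvg_ip (z := x) (sqrt_lim_cvg y).
  rewrite (ipC x); apply: (cvg_unique (@Rhausdorff R) h1); rewrite /=.
  have -> : (fun n => ip (sqrt_iter n x) y) = (fun n => ip (sqrt_iter n y) x).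
    by apply/funext => n; rewrite sqrt_iterC ipC.
  exact: h2.
- move=> x; rewrite -!nrm_sqr ler_pXn2r ?nnegrE ?nrm_ge0//.
  apply: cvg_le_cst (hcvg_nrm (sqrt_lim_cvg x)) _ => n.
  apply: le_trans (sqrt_iter_nrm n x) _.
  have /andP[] := scalar_iter_bound n; have := nrm_ge0 x; nra.
Qed.

Lemma sqrt_limE x : sqrt_lim x = 2^-1%:C *: (B x + sqrt_lim (sqrt_lim x)).
Proof.
have cS : hcvg (fun n => sqrt_iter n.+1 x) (sqrt_lim x).
  by apply/hcvgP; have /hcvgP := sqrt_lim_cvg x; rewrite (cvg_shiftS (fun n => sqrt_iter n x)).
apply: hcvg_unique cS _.
apply/hcvgP; apply: cvgZr; apply/hcvgP; apply: hcvgD; first exact: hcvg_cst.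
(* Both factors move with n: the first summand vanishes since all X_n are contractions, the second
   converges at a fixed vector. *)
have -> : (fun n => sqrt_iter n (sqrt_iter n x)) =
  (fun n => sqrt_iter n (sqrt_iter n x - sqrt_lim x) + sqrt_iter n (sqrt_lim x)).
  by apply/funext => n; rewrite -(linear_mapD (sqrt_iter_linear n)) subrK.
rewrite -[X in hcvg _ X]add0r; apply: hcvgD (sqrt_lim_cvg _).
apply: hcvg_le (sqrt_lim_cvg x) => n; rewrite subr0.
have [s0 s1] := andP (scalar_iter_bound n).
rewrite -[leRHS]mul1r -(expr1n _ 2); apply: nrm_le => //.
apply: le_trans (sqrt_iter_nrm n _) _.
by rewrite ler_wpM2r// nrm_ge0.
Qed.

(** Each iterate is a polynomial in B, so T commutes with it, and continuity of T carries this to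
    the limit. *)
Lemma sqrt_lim_commute T : sym_contraction T -> (forall x, T (B x) = B (T x)) ->
  forall x, T (sqrt_lim x) = sqrt_lim (T x).
Proof.
move=> cT TB x; have lT := sym_contraction_linear cT.
have Tn n y : T (sqrt_iter n y) = sqrt_iter n (T y).
  elim: n y => [|n IH] y /=; first exact: linear_map0.
  by rewrite (linear_mapZ lT) (linear_mapD lT) TB !IH.
apply: hcvg_unique (sym_contraction_hcvg cT (sqrt_lim_cvg x)) _.
by rewrite /comp; under eq_fun do rewrite Tn; exact: sqrt_lim_cvg.
Qed.

End Iteration.

Lemma sym_contraction_abs_ip T x : sym_contraction T -> ip (T x) x <= ip x x.
Proof.
move=> cT; have := sym_contraction_le cT x; have := ip_ge0 (T x - x).
by rewrite !ipE (ipC x (T x)); lra.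
Qed.

(* The limit [X] of [X_(n+1) = (B + X_n^2) / 2] satisfies [(1 - X)^2 = 1 - B]. *)
Lemma exists_sqrt B : sym_contraction B -> exists P,
  [/\ sym_contraction (fun x => x - P x), forall x, P (P x) = x - B x,
      forall x, 0 <= ip (P x) x &
      forall T, sym_contraction T -> (forall x, T (B x) = B (T x)) ->
        forall x, T (P x) = P (T x)].
Proof.
move=> cB; pose X := sqrt_lim cB.
have cX : sym_contraction X := sqrt_lim_contraction cB.
have lX : linear_map X := sym_contraction_linear cX.
exists (fun x => x - X x); split.
- by under eq_fun do rewrite subKr.
- move=> x; rewrite (linear_mapB lX).
  have := sqrt_limE cB x; rewrite -/X.
  move=> /(congr1 (fun z => 2%:C *: z)); rewrite scalerA -rmorphM /= divff// scale1r.
  rewrite rmorph_nat scaler_nat mulr2n => h.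
  have -> : B x = X x + X x - X (X x) by rewrite h addrK.
  by rewrite -[LHS]addrA -opprD addrA.
- by move=> x; rewrite ipDl ipNl subr_ge0 sym_contraction_abs_ip.
- move=> T cT TB x; rewrite (linear_mapB (sym_contraction_linear cT)).
  by rewrite (sqrt_lim_commute cB).
Qed.

Lemma sym_contraction_linearN T : linear_map (fun x => x - T x) -> linear_map T.
Proof. by move=> /linear_map_sub; under eq_fun do rewrite subKr. Qed.

Lemma resolvent_like_contraction J : resolvent_like J -> sym_contraction J.
Proof.
move=> [Jl Jc Jle]; split => // x.
have := Jle x; have := ip_ge0 (x - J x); rewrite !ipE (ipC (J x) x); lra.
Qed.

Lemma resolvent_like_sub J : resolvent_like J -> resolvent_like (fun x => x - J x).
Proof.
move=> [Jl Jc Jle]; split; first exact: linear_map_sub.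
- by move=> x y; rewrite !ipE Jc.
- by move=> x; have := Jle x; rewrite !ipE (ipC (J x) x); lra.
Qed.

(** Apply [exists_sqrt] to 1 - J for P and to J for Q; its commutation clause makes P and Q commute.
    Positivity of P Q will become nonnegativity of the unbounded root Q P^-1. *)
Lemma exists_sqrt_pair J : resolvent_like J -> exists P Q,
  [/\ sym_contraction P /\ sym_contraction Q, forall x, P (Q x) = Q (P x),
      forall x, P (P x) = J x, forall x, Q (Q x) = x - J x &
      forall x, 0 <= ip (P (Q x)) x].
Proof.
move=> rJ; have cJ := resolvent_like_contraction rJ.
have rJ' := resolvent_like_sub rJ; have cJ' := resolvent_like_contraction rJ'.
have sub_sqrt P' J' : resolvent_like J' -> sym_contraction (fun x => x - P' x) ->
    (forall x, P' (P' x) = J' x) -> sym_contraction P'.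
  move=> rJ'' cP sq; have lP := sym_contraction_linearN (sym_contraction_linear cP).
  have symP x y : ip (P' x) y = ip x (P' y).
    by have := sym_contractionC cP x y; rewrite !ipE; lra.
  split => // x; rewrite symP sq ipC sym_contraction_abs_ip//.
  exact: resolvent_like_contraction.
have [P [cP' PP P0 Pcom]] := exists_sqrt cJ'.
have [Q [cQ' QQ Q0 Qcom]] := exists_sqrt cJ.
have PP' x : P (P x) = J x by rewrite PP subKr.
have cP := sub_sqrt _ _ rJ cP' PP'.
have cQ := sub_sqrt _ _ rJ' cQ' QQ.
have QJ x : J (Q x) = Q (J x) by exact: Qcom.
have QP x : Q (P x) = P (Q x).
  by apply: Pcom => // y; rewrite (linear_mapB (sym_contraction_linear cQ)) QJ.
(* With S^2 = P and S commuting with Q, (P Q x, x) = (Q S x, S x) >= 0. *)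
have [S [cS' SS S0 Scom]] := exists_sqrt cP'.
have SS' x : S (S x) = P x by rewrite SS subKr.
have symS x y : ip (S x) y = ip x (S y).
  by have := sym_contractionC cS' x y; rewrite !ipE; lra.
have QS x : Q (S x) = S (Q x).
  by apply: Scom => // y; rewrite (linear_mapB (sym_contraction_linear cQ)) QP.
exists P, Q; split=> // x.
by rewrite -SS' symS -QS; exact: Q0.
Qed.

End SquareRoot.

(** * Nonnegative selfadjoint relations and their resolvents *)

Section Relations.
Context (R : realType) (H : hilbertType R).
Implicit Types (A S : set (H * H)) (J P Q : H -> H) (D K : set H).

Lemma submod_closedP (V : lmodType R[i]) (D : set V) :
  GRing.submod_closed [in D] <-> csubspace D.
Proof.
split=> [[D0 Dl]|[D0 Dl]].
  split=> [|c x y Dx Dy]; first by move: D0; rewrite inE.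
  by have := Dl c x y; rewrite !inE; apply.
by split=> [|c x y]; rewrite !inE => //; exact: Dl.
Qed.

Lemma orthocomplP D x : csubspace D ->
  orthocompl D x <-> forall y, D y -> ip x y = 0.
Proof. by move=> sD; apply: dotp_eq0P => y; exact: csubspaceZ. Qed.

Lemma orthocompl_csubspace D : csubspace (orthocompl D).
Proof.
split=> [y _|c x y Dx Dy z Dz]; first by rewrite linear0l.
by rewrite linearDl /= linearZl_LR /= Dx// Dy// mulr0 addr0.
Qed.

Lemma orthocompl_inj D x y : csubspace D -> orthocompl D x -> orthocompl D y ->
  (forall z, orthocompl D z -> ip z x = ip z y) -> x = y.
Proof.
move=> sD Dx Dy xy; have Dxy := csubspaceB (orthocompl_csubspace D) Dx Dy.
apply/eqP; rewrite -subr_eq0; apply/eqP/ip_eq0.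
by rewrite {1}ipDr ipNr !xy// subrr.
Qed.

Lemma orthocompl_hcvg D (u : nat -> H) a : csubspace D ->
  (forall n, orthocompl D (u n)) -> hcvg u a -> orthocompl D a.
Proof.
move=> sD Du ua; apply/orthocomplP => // y Dy.
apply: (cvg_unique (@Rhausdorff R) (hcvg_ip (z := y) ua)).
rewrite (_ : (fun n => _) = fun=> 0); first exact: cvg_cst.
by apply/funext => n; apply: (orthocomplP _ sD).1.
Qed.

Lemma orthogonal_projection D h : csubspace D ->
  (forall (u : nat -> H) a, (forall n, D (u n)) -> hcvg u a -> D a) ->
  exists2 m, D m & orthocompl D (h - m).
Proof.
move=> sD cD.
have pP : semi_inner D (@ip R H).
  by split=> [r x y z _ _ _|x y _ _|x _]; rewrite ?ipE//; [exact: ipC|exact: ip_ge0].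
have [||v [Dv vC vl]] := riesz_sequence sD pP (l := ip h) (M := ip h h).
- by move=> r x y _ _; rewrite !ipE.
- by move=> v Dv; have := ip_ge0 (h - v); rewrite !ipE (ipC v h); lra.
have [m vm] := hcvg_cauchy vC (eps_cvg 2).
exists m; first exact: cD vm.
apply/orthocomplP => // y Dy; rewrite !ipE; apply/eqP; rewrite subr_eq0; apply/eqP.
apply: (@cvg_sqr_bound_eq _ (fun n => ip (v n) y) _ _ (fun n => ip y y * eps R n)).
- by move=> n; rewrite [ip y y * _]mulrC; exact: vl.
- exact: eps_cvg.
- exact: hcvg_ip.
Qed.

Lemma adjointP A g : csubspace A ->
  adjoint A g <-> forall f, A f -> ip f.2 g.1 = ip f.1 g.2.
Proof.
move=> sA; split=> [Ag f Af|Ag f Af]; first by rewrite /ip Ag.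
rewrite !dotpE Ag//; have := Ag _ (csubspaceZ sA 'i%C Af).
by rewrite /= !ip_iC => /oppr_inj ->.
Qed.

Lemma adjoint_closed A : csubspace A -> closed (adjoint A).
Proof.
move=> sA; apply/closed_seqP => u v a b Auv ua vb.
apply/(adjointP _ sA) => -[f f'] Af /=.
rewrite !(ipC f) !(ipC f').
apply: (cvg_unique (@Rhausdorff R) (hcvg_ip (z := f') ua)).
rewrite (_ : (fun n => _) = fun n => ip (v n) f); first exact: hcvg_ip.
apply/funext => n; have /(adjointP _ sA)/(_ _ Af) /= := Auv n.
by rewrite ipC => ->; rewrite ipC.
Qed.

(** The real conditions suffice: testing f against i f shows that [dotp f.2 f.1] is real, and an
    adjoint is always closed. *)
Lemma nonneg_selfadjointP A : nonneg_selfadjoint A <->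
  [/\ csubspace A, forall g, A g <-> (forall f, A f -> ip f.2 g.1 = ip f.1 g.2) &
      forall f, A f -> 0 <= ip f.2 f.1].
Proof.
split=> [[[/submod_closedP sA cA] aA nA]|[sA aA nA]].
  split=> // [g|f Af]; last by have := nA f Af; rewrite lecE /= => /andP[].
  by rewrite {1}aA; exact: adjointP.
have AE : A = adjoint A by apply/seteqP; split => g; rewrite adjointP// aA.
split=> //; first by split; [exact/submod_closedP|rewrite AE; exact: adjoint_closed].
move=> f Af; have := (aA f).1 Af _ (csubspaceZ sA 'i%C Af).
rewrite /= ip_iC (ipC ('i%C *: f.1)) => fe.
have f0 : ip f.2 ('i%C *: f.1) = 0 by lra.
by rewrite dotpE f0 mulr0 addr0 ler0c nA.
Qed.

Definition resolvent_graph J : set (H * H) := [set f | J (f.1 + f.2) = f.1].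

Lemma resolvent_graph_apply J h : resolvent_graph J (J h, h - J h).
Proof. by rewrite /resolvent_graph /= addrC subrK. Qed.

Lemma resolvent_graphE J f : resolvent_graph J f ->
  f.1 = J (f.1 + f.2) /\ f.2 = f.1 + f.2 - J (f.1 + f.2).
Proof. by rewrite /resolvent_graph /= => ->; rewrite addrAC subrr add0r. Qed.

Lemma resolvent_graph_csubspace J : resolvent_like J -> csubspace (resolvent_graph J).
Proof.
move=> rJ; have lJ : linear_map J := resolvent_likeP rJ.
split; first by rewrite /resolvent_graph /= addr0 linear_map0.
move=> c f g; rewrite /resolvent_graph /= => fJ gJ.
by rewrite addrACA -scalerDr lJ fJ gJ.
Qed.

Lemma resolvent_graph_selfadjoint J : resolvent_like J ->
  nonneg_selfadjoint (resolvent_graph J).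
Proof.
move=> rJ; have sJ := resolvent_graph_csubspace rJ.
have lJ : linear_map J := resolvent_likeP rJ.
apply/nonneg_selfadjointP; split => // [g|f /resolvent_graphE[]]; last first.
  move: (f.1 + f.2) => h -> ->; have := resolvent_like_le rJ h.
  by rewrite !ipE; lra.
split=> [/resolvent_graphE[]|gJ].
  move: (g.1 + g.2) => h -> -> f /resolvent_graphE[].
  move: (f.1 + f.2) => k -> ->.
  by rewrite !ipE !(resolvent_likeC rJ); lra.
apply: ip_inj => h; have := gJ _ (resolvent_graph_apply J h).
by rewrite /= (linear_mapD lJ) !ipE !(resolvent_likeC rJ); lra.
Qed.

(** Project h onto the range of A + 1. Nonnegativity gives |f.1|^2 + |f.2|^2 <= |f.1 + f.2|^2, so
    approximating pairs converge in both components, to a pair of the closed set A. *)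
Lemma exists_resolvent A : nonneg_selfadjoint A ->
  exists2 J, resolvent_like J & A = resolvent_graph J.
Proof.
move=> sa; have /nonneg_selfadjointP[sA aA nA] := sa.
have [[_ cA] _ _] := sa; move/closed_seqP in cA.
pose p (f g : H * H) := ip (f.1 + f.2) (g.1 + g.2).
have pP : semi_inner A p.
  split=> [r f g k _ _ _|f g _ _|f _]; rewrite /p.
  - by rewrite /= !ipE; ring.
  - exact: ipC.
  - exact: ip_ge0.
have p_ge f : A f -> ip f.1 f.1 <= p f f /\ ip f.2 f.2 <= p f f.
  move=> Af; have := nA f Af; have := ip_ge0 f.1; have := ip_ge0 f.2.
  by rewrite /p !ipE (ipC f.1 f.2); split; lra.
suff ex h : exists u, A (u, h - u).
  have [J JA] := choice ex.
  (* Two solutions differ by some d with (d, -d) in A, and nonnegativity gives -|d|^2 >= 0. *)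
  have JU u h : A (u, h - u) -> u = J h.
    move=> Au; have Auh := csubspaceB sA Au (JA h).
    apply/eqP; rewrite -subr_eq0; apply/eqP/ip_eq0/le_anti; rewrite ip_ge0 andbT.
    have := nA _ Auh; rewrite /=.
    have -> : h - u - (h - J h) = - (u - J h).
      by rewrite opprB [LHS]addrC addrA subrK opprB.
    by rewrite ipNl oppr_ge0.
  have lJ : linear_map J.
    move=> c x y; apply/esym/JU.
    rewrite (_ : c *: x + y - _ = c *: (x - J x) + (y - J y)).
      exact: csubspaceP sA c _ _ (JA x) (JA y).
    by rewrite scalerBr opprD addrACA.
  have symJ x y : ip (J x) y = ip x (J y).
    have := (aA _).1 (JA x) _ (JA y).
    by rewrite /= !ipE (ipC (J x) y) (ipC x (J y)); lra.
  exists J; first split => //.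
    move=> x; have := nA _ (JA x); rewrite /= !ipE; lra.
  apply/seteqP; split => -[f f'] /=; rewrite /resolvent_graph /=.
    by move=> Af; apply/esym/JU; rewrite addrC addKr.
  by move=> Jf; have := JA (f + f'); rewrite Jf addrC addKr.
have [||v [Dv vC vl]] := riesz_sequence sA pP (l := fun f => ip h (f.1 + f.2)) (M := ip h h).
- by move=> r f g _ _; rewrite /= !ipE; ring.
- move=> f Af; have := ip_ge0 (h - (f.1 + f.2)).
  rewrite /p; move: (f.1 + f.2) => g; rewrite !ipE (ipC g h); lra.
have [a va] : exists a, hcvg (fun n => (v n).1) a.
  apply: hcvg_cauchy (eps_cvg 2) => n m.
  by apply: le_trans (vC n m); have [] := p_ge _ (csubspaceB sA (Dv n) (Dv m)).
have [b vb] : exists b, hcvg (fun n => (v n).2) b.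
  apply: hcvg_cauchy (eps_cvg 2) => n m.
  by apply: le_trans (vC n m); have [] := p_ge _ (csubspaceB sA (Dv n) (Dv m)).
have Aab : A (a, b).
  by apply: cA va vb => n; have := Dv n; case: (v n).
have orth f : A f -> ip (h - (a + b)) (f.1 + f.2) = 0.
  move=> Af; rewrite ipDl ipNl; apply/eqP; rewrite subr_eq0; apply/eqP.
  apply: (@cvg_sqr_bound_eq _ (fun n => ip ((v n).1 + (v n).2) (f.1 + f.2)) _ _
    (fun n => p f f * eps R n)).
  - by move=> n; rewrite [p f f * _]mulrC; exact: vl.
  - exact: eps_cvg.
  - by apply: hcvg_ip; exact: hcvgD.
have [k kE] : exists k, k = h - (a + b) by exists (h - (a + b)).
rewrite -kE in orth.
(* The remainder k is orthogonal to the range of A + 1, so (k, -k) lies in the adjoint of A, which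
   is A. *)
have Ak : A (k, - k).
  by apply/aA => f Af /=; have := orth f Af; rewrite !ipE !(ipC k); lra.
have k0 : k = 0.
  apply: ip_eq0; apply/le_anti; rewrite ip_ge0 andbT.
  by have := nA _ Ak; rewrite /= ipNl oppr_ge0.
exists a; have -> : h - a = b; last by [].
by move/eqP: k0; rewrite kE subr_eq0 => /eqP ->; rewrite addrC addKr.
Qed.

Lemma resolvent_graph_resolvent J h : resolvent (resolvent_graph J) h = J h.
Proof.
apply: get_unique => [|y].
  by exists (J h, h - J h); [exact: resolvent_graph_apply|rewrite /= subrK].
by move=> [f fJ [<- <-]]; rewrite addrC fJ.
Qed.

Lemma rinv_resolvent_graph J : resolvent_like J ->
  rinv (resolvent_graph J) = resolvent_graph (fun h => h - J h).
Proof.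
move=> rJ; apply/seteqP; split=> -[f f']; rewrite /rinv /resolvent_graph /= [f' + f]addrC.
  by move=> ->; rewrite addrK.
by move=> h; apply: (addrI f); rewrite -{1}h subrK.
Qed.

End Relations.

(** * The square root of the operator part and the form it defines *)

Section SquareRootForm.
Context (R : realType) (H : hilbertType R).
Implicit Types (A S : set (H * H)) (D : set H).

Section Fixed.
Context (J : H -> H) (rJ : resolvent_like J).
Let lJ : linear_map J := resolvent_likeP rJ.
Let N := rmul (resolvent_graph J).
Let K := orthocompl N.
Let T := op_part (resolvent_graph J).

Lemma rmul_resolvent_graph x : N x <-> J x = 0.
Proof. by rewrite /N /rmul /= /resolvent_graph /= add0r. Qed.

Lemma rmul_resolvent_graph_csubspace : csubspace N.
Proof.
split=> [|c x y]; first by apply/rmul_resolvent_graph; exact: linear_map0.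
move=> /rmul_resolvent_graph Jx /rmul_resolvent_graph Jy.
by apply/rmul_resolvent_graph; rewrite lJ Jx Jy scaler0 addr0.
Qed.

Let sN := rmul_resolvent_graph_csubspace.

Lemma orthocompl_resolvent h : K (J h).
Proof.
apply/(orthocomplP _ sN) => y /rmul_resolvent_graph Jy.
by rewrite (resolvent_likeC rJ) Jy ip0r.
Qed.

(** The multivalued part is ker J, so J ignores the component of h along it. *)
Lemma resolvent_projection h : exists2 k, K k & J k = J h.
Proof.
have [|m /rmul_resolvent_graph Jm Km] := orthogonal_projection h sN.
  move=> u a Nu ua; apply/rmul_resolvent_graph.
  have := sym_contraction_hcvg (resolvent_like_contraction rJ) ua.
  rewrite (_ : J \o u = fun=> 0); last first.
    by apply/funext => n /=; exact/rmul_resolvent_graph.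
  by move=> /hcvg_unique; apply; exact: hcvg_cst.
by exists (h - m) => //; rewrite (linear_mapB lJ) Jm subr0.
Qed.

Lemma op_part_resolvent_graphP f :
  T f <-> [/\ J (f.1 + f.2) = f.1, K f.1 & K f.2].
Proof.
split=> [[Jf Kf]|[Jf _ Kf]]; last by split.
by split=> //; rewrite -Jf; exact: orthocompl_resolvent.
Qed.

(* With [P^2 = J] and [Q^2 = 1 - J], the square root is [{(P k, Q k) | k in K}]. *)
Lemma exists_sqrt_op : exists S,
  nonneg_selfadjoint_operator_in K S /\ (S \; S)%relation = T.
Proof.
have [P [Q [[cP cQ] PQ PP QQ PQ0]]] := exists_sqrt_pair rJ.
have [lP lQ] := (sym_contraction_linear cP, sym_contraction_linear cQ).
have JP x : J (P x) = P (J x) by rewrite -!PP.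
have JQ x : J (Q x) = Q (J x) by rewrite -!PP !PQ.
have KP x : K x -> K (P x).
  move=> /(orthocomplP _ sN) Kx; apply/(orthocomplP _ sN) => y /rmul_resolvent_graph Jy.
  rewrite (sym_contractionC cP) Kx//; apply/rmul_resolvent_graph.
  by rewrite JP Jy linear_map0.
have KQ x : K x -> K (Q x).
  move=> /(orthocomplP _ sN) Kx; apply/(orthocomplP _ sN) => y /rmul_resolvent_graph Jy.
  rewrite (sym_contractionC cQ) Kx//; apply/rmul_resolvent_graph.
  by rewrite JQ Jy linear_map0.
have sK : csubspace K := orthocompl_csubspace N.
(* An equation between bounded operators makes closedness immediate; [SP] and [Sk] recover the
   parametrization. *)
pose S : set (H * H) := [set f | [/\ K f.1, K f.2 & Q f.1 = P f.2]].
have SP f : S f -> exists k, [/\ K k, f.1 = P k & f.2 = Q k].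
  (* Since P^2 + Q^2 = 1, the pair (P k, Q k) returns k this way. *)
  move=> [K1 K2 fE]; exists (P f.1 + Q f.2); split.
  - exact: (csubspaceD sK (KP _ K1) (KQ _ K2)).
  - by rewrite (linear_mapD lP) PP PQ -fE QQ addrC subrK.
  - by rewrite (linear_mapD lQ) QQ -PQ fE PP addrC subrK.
have Sk k : K k -> S (P k, Q k).
  by move=> Kk; split; rewrite /= ?PQ//; [exact: KP|exact: KQ].
have sS : csubspace S.
  split=> [|c f g [f1 f2 fE] [g1 g2 gE]].
    by split; rewrite /= ?linear_map0//; exact: (csubspace0 sK).
  split; [exact: (csubspaceP sK)|exact: (csubspaceP sK)|].
  by rewrite /= lQ lP fE gE.
exists S; split; last first.
  apply/seteqP; split=> -[f f'].
    move=> [g [/= Kf Kg e1] [_ /= Kf' e2]]; apply/op_part_resolvent_graphP; split=> //=.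
    by rewrite (linear_mapD lJ) -!PP -e2 PQ -e1 QQ PP addrC subrK.
  move=> /op_part_resolvent_graphP[/= Jf Kf Kf'].
  (* With h = f + f', f = P^2 h and f' = Q^2 h, so P Q h is the middle point of the composition. *)
  have f'E : Q (Q (f + f')) = f' by rewrite QQ Jf addrAC subrr add0r.
  have KPQ : K (P (Q (f + f'))) := KP _ (KQ _ (csubspaceD sK Kf Kf')).
  exists (P (Q (f + f'))); split=> //=.
    by rewrite -{1}Jf -PP PQ.
  by rewrite -PQ f'E.
split.
- split; last first.
    apply/seteqP; split=> [f' [_ /= Kf' Qf]|_ ->]; last exact: (csubspace0 sS).
    (* P f' = Q 0 = 0 puts f' in ker J as well as in its orthogonal complement. *)
    apply/ip_eq0; apply: (orthocomplP _ sN).1 (Kf') _ _; apply/rmul_resolvent_graph.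
    by rewrite -PP -Qf linear_map0 ?linear_map0.
  split; first exact/submod_closedP.
  apply/closed_seqP => u v a b Suv ua vb; split=> /=.
  - by apply: orthocompl_hcvg ua => // n; have [] := Suv n.
  - by apply: orthocompl_hcvg vb => // n; have [] := Suv n.
  - apply: hcvg_unique (sym_contraction_hcvg cQ ua) _.
    rewrite (_ : Q \o u = P \o v); first exact: sym_contraction_hcvg.
    by apply/funext => n /=; have [] := Suv n.
- by move=> f [].
- apply/seteqP; split=> [g Sg|g [/(adjointP _ sS) Sg [Kg1 Kg2]]].
    split; last by have [] := Sg.
    apply/(adjointP _ sS) => f /SP[k [Kk -> ->]].
    by have [_ _ gE] := Sg; rewrite (sym_contractionC cQ) (sym_contractionC cP) gE.
  split=> //; apply: (orthocompl_inj sN); [exact: KQ|exact: KP|].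
  move=> k Kk; have := Sg _ (Sk k Kk).
  by rewrite /= (sym_contractionC cQ) (sym_contractionC cP).
- move=> f Sf; have [k [Kk -> ->]] := SP _ Sf.
  have sym : ip (Q k) ('i%C *: P k) = 0.
    have e1 : ip (Q k) ('i%C *: P k) = ip (P k) ('i%C *: Q k).
      rewrite -!(linear_mapZ lP) -(linear_mapZ lQ) -(sym_contractionC cP) PQ.
      exact: (sym_contractionC cQ).
    by have := ip_iC (Q k) (P k); rewrite ipC; lra.
  by rewrite dotpE sym mulr0 addr0 ler0c -(sym_contractionC cP) PQ0.
Qed.

Lemma sqrt_op_partP : nonneg_selfadjoint_operator_in K (sqrt_op K T) /\
  (sqrt_op K T \; sqrt_op K T)%relation = T.
Proof. exact: getPex exists_sqrt_op. Qed.

End Fixed.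

Section Operator.
Context (S : set (H * H)) (sS : csubspace S) (cS : closed S).
Hypothesis mulS : rmul S = [set 0].

Lemma rapplyP x : rdom S x -> S (x, rapply S x).
Proof. exact: getPex. Qed.

Lemma rapply_eq x y : S (x, y) -> rapply S x = y.
Proof.
move=> Sxy; have Sx : S (x, rapply S x) by apply: rapplyP; exists y.
have := csubspaceB sS Sx Sxy => S0; apply/eqP; rewrite -subr_eq0; apply/eqP.
have : rmul S (rapply S x - y) by rewrite /rmul /= -(subrr x).
by rewrite mulS.
Qed.

Lemma rapply_linear c x y : rdom S x -> rdom S y ->
  rapply S (c *: x + y) = c *: rapply S x + rapply S y.
Proof.
move=> /rapplyP Sx /rapplyP Sy; apply: rapply_eq.
exact: (csubspaceP sS c Sx Sy).
Qed.

Lemma rdom_csubspace : csubspace (rdom S).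
Proof.
split; first by exists 0; exact: (csubspace0 sS).
move=> c x y [x' Sx] [y' Sy]; exists (c *: x' + y').
exact: (csubspaceP sS c Sx Sy).
Qed.

Definition graph_form x y := ip x y + ip (rapply S x) (rapply S y).

(** The form norm is the graph norm of S, so completeness is closedness of the graph. *)
Lemma graph_form_closed : closed_form (rdom S) graph_form.
Proof.
have sD := rdom_csubspace.
have app c x : rdom S x -> rapply S (c *: x) = c *: rapply S x.
  move=> Sx; apply: rapply_eq; exact: (csubspaceZ sS c (rapplyP Sx)).
have appB x y : rdom S x -> rdom S y -> rapply S (x - y) = rapply S x - rapply S y.
  move=> Sx Sy; apply: rapply_eq; exact: (csubspaceB sS (rapplyP Sx) (rapplyP Sy)).
split=> //.
- split=> [r x y z Dx Dy _|x y _ _|x _]; rewrite /graph_form.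
  + by rewrite rapply_linear// !ipE; ring.
  + by rewrite ipC (ipC (rapply _ _)).
  + by rewrite addr_ge0 ?ip_ge0.
- by move=> x _; rewrite /graph_form lerDl ip_ge0.
- by move=> x y Dx Dy; rewrite /graph_form !app// !ip_i.
- move=> v y Dv vC y0.
  have dE n a : rdom S a -> graph_form (v n - a) (v n - a) =
      ip (v n - a) (v n - a) + ip (rapply S (v n) - rapply S a) (rapply S (v n) - rapply S a).
    by move=> Da; rewrite /graph_form appB.
  have [a va] : exists a, hcvg v a.
    apply: hcvg_cauchy y0 => n m; apply: le_trans (vC n m).
    by rewrite dE// lerDl ip_ge0.
  have [b vb] : exists b, hcvg (fun n => rapply S (v n)) b.
    apply: hcvg_cauchy y0 => n m; apply: le_trans (vC n m).
    by rewrite dE// lerDr ip_ge0.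
  have Sab : S (a, b).
    by move/closed_seqP: cS; apply; [|exact: va|exact: vb] => n; exact: rapplyP.
  have Da : rdom S a by exists b.
  exists a => //; under eq_fun do rewrite dE// (rapply_eq Sab).
  by have h := cvgD va vb; rewrite addr0 in h; apply: h.
Qed.

End Operator.

(* [p] is the form of [A] shifted by the inner product, [J] its resolvent. *)
Record form_data A J (p : H -> H -> R) : Prop := FormData {
  form_data_resolvent : resolvent_like J;
  form_data_graph : A = resolvent_graph J;
  form_data_closed : closed_form (rel_form_dom A) p;
  form_data_represents : represents J (rel_form_dom A) p;
  form_data_rel_form : forall x, rel_form A x = (p x x - ip x x)%:C }.

(** Let k be the projection of h and s = S (J h), so S s = k - J h. Selfadjointness of S gives p(J
    h, x) = (J h, x) + (s, S x) = (k, x), which is (h, x) because x is orthogonal to the multivalued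
    part. *)
Lemma exists_form_data A : nonneg_selfadjoint A -> exists J p, form_data A J p.
Proof.
move=> /exists_resolvent[J rJ AJ]; exists J.
have := sqrt_op_partP rJ; rewrite -!AJ -/(sqrt_op_part A).
set S := sqrt_op_part A; set K := orthocompl _.
move=> [[[[/submod_closedP sS cS] mulS] SK SE nS] SS].
exists (graph_form S); split=> //.
- exact: graph_form_closed.
- have sN := rmul_resolvent_graph_csubspace rJ.
  move=> h; have [k Kk Jk] := resolvent_projection rJ h.
  rewrite -AJ -/K in Kk.
  have [s Sus Ssk] : exists2 s, S (J h, s) & S (s, k - J h).
    suff : (S \; S)%relation (J h, k - J h) by [].
    rewrite SS AJ; apply/(op_part_resolvent_graphP rJ) => /=.
    have KJ := orthocompl_resolvent rJ h.
    split=> //; first by rewrite addrC subrK.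
    by apply: (csubspaceB (orthocompl_csubspace _)) => //; rewrite -AJ.
  have DJ : rdom S (J h) by exists s.
  split=> // x Dx; rewrite /graph_form (rapply_eq sS mulS Sus).
  have Sx := rapplyP Dx.
  have : adjoint S (s, k - J h) by move: Ssk; rewrite {1}SE => -[].
  move=> /(adjointP _ sS)/(_ _ Sx) /= sx.
  rewrite [ip s _]ipC sx (ipC x) -ipDl addrC subrK.
  have Kx : K x by have [] := SK _ Sx.
  have hk : rmul A (h - k).
    rewrite AJ; apply/rmul_resolvent_graph.
    by rewrite (linear_mapB (resolvent_likeP rJ)) Jk subrr.
  rewrite AJ in hk; move: Kx; rewrite /K AJ => /(orthocomplP _ sN)/(_ _ hk).
  by rewrite ipC ipDl ipNl => /eqP; rewrite subr_eq0 => /eqP.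
- by move=> x; rewrite /rel_form -/S norm_ip /graph_form addrAC subrr add0r.
Qed.

End SquareRootForm.

(** * Order, form sums and monotone limits *)

Section Convergence.
Context (R : realType) (H : hilbertType R).
Implicit Types (A B C : set (H * H)) (J : H -> H) (p : H -> H -> R).

Lemma form_data_selfadjoint A J p : form_data A J p -> nonneg_selfadjoint A.
Proof.
move=> d; rewrite (form_data_graph d).
exact/resolvent_graph_selfadjoint/(form_data_resolvent d).
Qed.

Lemma form_data_dual A J p x M : form_data A J p ->
  (forall h, 2 * ip h x - ip h (J h) <= M) <-> rel_form_dom A x /\ p x x <= M.
Proof.
move=> [rJ _ cA rep _]; split; first exact: (represents_dual_ge cA rep).
by move=> [Ax xM] h; apply: le_trans xM; exact: (represents_dual_le cA rep).
Qed.

Lemma form_data_ip A J p h : form_data A J p -> p (J h) (J h) = ip h (J h).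
Proof. by move=> [_ _ _ rep _]; rewrite (representsE rep)//; exact: (representsD rep). Qed.

Lemma form_data_dom A J p h : form_data A J p -> rel_form_dom A (J h).
Proof. by move=> [_ _ _ rep _]; exact: (representsD rep). Qed.

(** Left to right, test duality at J' h: 2 (h, J' h) - (h, J h) <= p(J' h, J' h) <= p'(J' h, J' h) =
    (h, J' h). *)
Lemma rel_leP A B J p J' p' : form_data A J p -> form_data B J' p' ->
  rel_le A B <-> forall h, ip h (J' h) <= ip h (J h).
Proof.
move=> dA dB; split=> [[AB le_p] h|J'J].
  have Bx := form_data_dom h dB.
  have := le_p _ Bx; rewrite (form_data_rel_form dA) (form_data_rel_form dB) lecR.
  have [_ /(_ (conj (AB _ Bx) (lexx _)) h)] := form_data_dual (J' h) (p (J' h) (J' h)) dA.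
  rewrite (form_data_ip _ dB); lra.
have key x : rel_form_dom B x -> rel_form_dom A x /\ p x x <= p' x x.
  move=> Bx; apply/(form_data_dual _ _ dA) => h.
  have [_ /(_ (conj Bx (lexx _)) h)] := form_data_dual x (p' x x) dB.
  have := J'J h; lra.
split=> [x /key[]//|x /key[Ax le_p]].
by rewrite (form_data_rel_form dA) (form_data_rel_form dB) lecR lerD2r.
Qed.

(** Each shifted form carries a copy of [ip], and the sum must keep only one. The limits for the two
    form norms agree because both dominate the norm of H. *)
Lemma closed_formD D D' p p' : closed_form D p -> closed_form D' p' ->
  closed_form (D `&` D') (fun x y => p x y + p' x y - ip x y).
Proof.
move=> [sD pP pge pi pc] [sD' pP' pge' pi' pc']; split.
- split=> [|c x y [Dx Dx'] [Dy Dy']].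
    by split; [exact: (csubspace0 sD)|exact: (csubspace0 sD')].
  by split; [exact: (csubspaceP sD)|exact: (csubspaceP sD')].
- split=> [r x y z [Dx Dx'] [Dy Dy'] [Dz Dz']|x y [Dx Dx'] [Dy Dy']|x [Dx Dx']].
  + by rewrite (semi_innerPl pP)// (semi_innerPl pP')// !ipE; ring.
  + by rewrite (semi_innerC pP)// (semi_innerC pP')// ipC.
  + by have := pge x Dx; have := semi_inner_ge0 pP' Dx'; lra.
- by move=> x [Dx Dx']; have := pge x Dx; have := pge' x Dx'; lra.
- by move=> x y [Dx Dx'] [Dy Dy']; rewrite pi// pi'// ip_i.
- move=> v y Dv vC y0.
  have Dvm n m : D (v n - v m) /\ D' (v n - v m).
    have [Dn Dn'] := Dv n; have [Dm Dm'] := Dv m.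
    by split; [exact: (csubspaceB sD)|exact: (csubspaceB sD')].
  have [||a Da va] := pc v y _ _ y0.
  + by move=> n; have [] := Dv n.
  + move=> n m; apply: le_trans (vC n m); have [_ D'v] := Dvm n m.
    by have := pge' _ D'v; lra.
  have [||b Db vb] := pc' v y _ _ y0.
  + by move=> n; have [] := Dv n.
  + move=> n m; apply: le_trans (vC n m); have [D_v _] := Dvm n m.
    by have := pge _ D_v; lra.
  have hva : hcvg v a.
    apply: hcvg_le va => n; apply: pge; apply: (csubspaceB sD) => //.
    by have [] := Dv n.
  have hvb : hcvg v b.
    apply: hcvg_le vb => n; apply: pge'; apply: (csubspaceB sD') => //.
    by have [] := Dv n.
  have ba : b = a by exact: hcvg_unique hvb hva.
  rewrite ba in Db vb; exists a => //.
  have h := cvgB (cvgD va vb) hva.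
  by rewrite addr0 subr0 in h; apply: h.
Qed.

(* A closed form is the form of some relation: both it and the form of the relation
   built from its resolvent are recovered from that resolvent by duality. *)
Lemma form_sumP A B : nonneg_selfadjoint A -> nonneg_selfadjoint B ->
  [/\ nonneg_selfadjoint (form_sum A B),
      rel_form_dom (form_sum A B) = rel_form_dom A `&` rel_form_dom B &
      forall x, (rel_form_dom A `&` rel_form_dom B) x ->
        rel_form (form_sum A B) x = rel_form A x + rel_form B x].
Proof.
move=> /exists_form_data[J [p dA]] /exists_form_data[J' [p' dB]].
rewrite /form_sum /rel_of_form; set D := _ `&` _.
apply: (@getPex _ [set C | [/\ nonneg_selfadjoint C, rel_form_dom C = D &
  forall x, D x -> rel_form C x = rel_form A x + rel_form B x]]).
have cq := closed_formD (form_data_closed dA) (form_data_closed dB).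
have [K rK] := exists_represents cq.
have sa := resolvent_graph_selfadjoint (represents_resolvent_like cq rK).
exists (resolvent_graph K) => /=.
have [K0 [p0 dC]] := exists_form_data sa.
have K0K : K0 = K.
  apply/funext => h; rewrite -(resolvent_graph_resolvent K) (form_data_graph dC).
  by rewrite resolvent_graph_resolvent.
rewrite K0K in dC.
set q := fun x y => _ in cq rK.
have CD x : rel_form_dom (resolvent_graph K) x -> D x /\ q x x <= p0 x x.
  move=> Cx; apply: (represents_dual_ge cq rK); apply/(form_data_dual _ _ dC).
  by split.
have DC x : D x -> rel_form_dom (resolvent_graph K) x /\ p0 x x <= q x x.
  move=> Dx; apply/(form_data_dual _ _ dC) => h.
  exact: (represents_dual_le cq rK).
split=> //; first by apply/seteqP; split=> x; [move=> /CD[]|move=> /DC[]].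
move=> x /DC[Cx le1]; have [_ le2] := CD x Cx.
rewrite (form_data_rel_form dC) (form_data_rel_form dA) (form_data_rel_form dB).
by rewrite -rmorphD; congr (_ %:C); move: le1 le2; rewrite /q; lra.
Qed.

Lemma form_sum_data A J p B J' p' K q : form_data A J p -> form_data B J' p' ->
  form_data (form_sum A B) K q ->
  forall x, rel_form_dom (form_sum A B) x -> [/\ rel_form_dom A x, rel_form_dom B x &
    q x x = p x x + p' x x - ip x x].
Proof.
move=> dA dB dE x.
have [_ -> relE] := form_sumP (form_data_selfadjoint dA) (form_data_selfadjoint dB).
move=> ABx; have [Ax Bx] := ABx; split=> //; have := relE x ABx.
rewrite (form_data_rel_form dA) (form_data_rel_form dB) (form_data_rel_form dE).
by rewrite -rmorphD => /complexI; lra.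
Qed.

(** The two conclusions together say that p is the supremum of the p_n, with value +oo outside the
    domain. Both follow from duality, as 2 (h, x) - (h, J_n h) increases to 2 (h, x) - (h, J h). *)
Lemma form_data_limit (A : nat -> set (H * H)) (J_ : nat -> H -> H)
    (p_ : nat -> H -> H -> R) C J p :
  (forall n, form_data (A n) (J_ n) (p_ n)) -> form_data C J p ->
  nondecreasing_rel A -> strong_resolvent_cvg A C ->
  (forall n x, rel_form_dom C x -> rel_form_dom (A n) x /\ p_ n x x <= p x x) /\
  (forall x M, (forall n, rel_form_dom (A n) x /\ p_ n x x <= M) ->
     rel_form_dom C x /\ p x x <= M).
Proof.
move=> dA dC ndA AC.
have cvgJ h : ip h (J_ n h) @[n --> \oo] --> ip h (J h).
  have /hcvgP/(hcvg_ip (z := h)) := AC h.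
  rewrite (form_data_graph dC) resolvent_graph_resolvent ipC.
  rewrite (_ : (fun n => _) = fun n => ip h (J_ n h))//.
  by apply/funext => n; rewrite (form_data_graph (dA n)) resolvent_graph_resolvent ipC.
have ndJ h n m : (n <= m)%N -> ip h (J_ m h) <= ip h (J_ n h).
  by move=> /ndA /(rel_leP (dA n) (dA m)); apply.
split=> [n x Cx|x M xM].
  apply/(form_data_dual _ _ (dA n)) => h.
  have [_ /(_ (conj Cx (lexx _)) h)] := form_data_dual x (p x x) dC.
  suff : ip h (J h) <= ip h (J_ n h) by lra.
  have := @cvg_ge_cst _ (fun k => - ip h (J_ k h)) (- ip h (J h)) (- ip h (J_ n h)) n.
  rewrite lerN2; apply; first exact: cvgN.
  by move=> k nk; rewrite lerN2 ndJ.
apply/(form_data_dual _ _ dC) => h.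
have cv : (2 * ip h x - ip h (J_ n h)) @[n --> \oo] --> 2 * ip h x - ip h (J h).
  by apply: cvgB => //; exact: cvg_cst.
apply: cvg_le_cst cv _ => n.
by have [_] := form_data_dual x M (dA n); apply.
Qed.

Lemma monotone_form_cvg (A : nat -> set (H * H)) (J_ : nat -> H -> H)
    (p_ : nat -> H -> H -> R) C J p :
  (forall n, form_data (A n) (J_ n) (p_ n)) -> form_data C J p ->
  nondecreasing_rel A ->
  (forall n x, rel_form_dom C x -> rel_form_dom (A n) x /\ p_ n x x <= p x x) ->
  (forall x M, (forall n, rel_form_dom (A n) x /\ p_ n x x <= M) ->
     rel_form_dom C x /\ p x x <= M) ->
  strong_resolvent_cvg A C.
Proof.
move=> dA dC ndA up low h.
rewrite (form_data_graph dC) resolvent_graph_resolvent.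
rewrite (_ : (fun n => _) = fun n => J_ n h); last first.
  by apply/funext => n; rewrite (form_data_graph (dA n)) resolvent_graph_resolvent.
have ndJ n m : (n <= m)%N -> ip h (J_ m h) <= ip h (J_ n h).
  by move=> /ndA /(rel_leP (dA n) (dA m)); apply.
have ndp n m x : (n <= m)%N -> rel_form_dom (A m) x ->
    rel_form_dom (A n) x /\ p_ n x x <= p_ m x x.
  move=> /ndA[AA le_p] Ax; split; first exact: AA.
  have := le_p x Ax; rewrite (form_data_rel_form (dA n)) (form_data_rel_form (dA m)).
  by rewrite lecR lerD2r.
have JC n : ip h (J h) <= ip h (J_ n h).
  suff /(rel_leP (dA n) dC) : rel_le (A n) C by apply.
  split=> [x /(up n)[]//|x /(up n)[_ le_p]].
  by rewrite (form_data_rel_form (dA n)) (form_data_rel_form dC) lecR lerD2r.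
have [L uL Lu] : exists2 L, ip h (J_ n h) @[n --> \oo] --> L & forall n, L <= ip h (J_ n h).
  apply: nonincreasing_cvg_ge0; first exact: ndJ.
  move=> n; apply: le_trans (ip_ge0 _) _; apply: resolvent_like_le.
  exact: form_data_resolvent (dA n).
(* Expand p_n at J_n h - J_m h, and bound p_n by p_m at J_m h, where p_m equals (h, J_m h). *)
have dist n m : (n <= m)%N ->
    ip (J_ m h - J_ n h) (J_ m h - J_ n h) <= ip h (J_ n h) - ip h (J_ m h).
  move=> nm; have [rJ _ cA rep _] := dA n.
  have Dm := (ndp n m _ nm (form_data_dom h (dA m))).
  have Dn := form_data_dom h (dA n).
  have Dnm := csubspaceB (closed_form_sub cA) Dn Dm.1.
  have := closed_form_ge cA Dnm.
  rewrite (semi_inner_sqrB (closed_form_sub cA) (closed_form_inner cA) Dn Dm.1).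
  rewrite (form_data_ip _ (dA n)) (representsE rep)//; last exact: Dm.1.
  have := Dm.2; rewrite (form_data_ip _ (dA m)).
  rewrite -(opprB (J_ n h)) ipNl ipNr opprK; lra.
have [u hu] : exists u, hcvg (fun n => J_ n h) u.
  apply: (@hcvg_cauchy _ _ _ (fun n => ip h (J_ n h) - L)); last first.
    by rewrite -(subrr L); apply: cvgB => //; exact: cvg_cst.
  move=> n m; have := Lu n; have := Lu m.
  case: (leqP n m) => [nm|/ltnW mn].
    by have := dist _ _ nm; rewrite -(opprB (J_ n h)) ipNl ipNr opprK; lra.
  by have := dist _ _ mn; lra.
have Lh : L = ip h u.
  have := hcvg_ip (z := h) hu; rewrite ipC => hu'.
  apply: (cvg_unique (@Rhausdorff R) uL).
  by rewrite (_ : (fun n => _) = fun n => ip (J_ n h) h)//; apply/funext => n; rewrite ipC.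
have [Cu puL] : rel_form_dom C u /\ p u u <= L.
  (* Lower semicontinuity through duality: for m >= n, 2 (k, J_m h) - (k, J_n k) <= p_n(J_m h, J_m
     h) <= (h, J_m h); then let m grow. *)
  apply: low => n; apply/(form_data_dual _ _ (dA n)) => k.
  have cv : (ip h (J_ m h) - (2 * ip k (J_ m h) - ip k (J_ n k))) @[m --> \oo] -->
      L - (2 * ip k u - ip k (J_ n k)).
    apply: cvgB => //; apply: cvgB; last exact: cvg_cst.
    apply: cvgM; first exact: cvg_cst.
    have := hcvg_ip (z := k) hu; rewrite ipC.
    rewrite (_ : (fun n => ip _ k) = fun n => ip k (J_ n h))//.
    by apply/funext => m; rewrite ipC.
  rewrite -subr_ge0; apply: (@cvg_ge_cst _ _ _ _ n cv) => m nm.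
  rewrite subr_ge0.
  have [_ pm] := ndp n m _ nm (form_data_dom h (dA m)).
  have [An _] := ndp n m _ nm (form_data_dom h (dA m)).
  have [_ /(_ (conj An (lexx _)) k)] :=
    form_data_dual (J_ m h) (p_ n (J_ m h) (J_ m h)) (dA n).
  by move: pm; rewrite (form_data_ip _ (dA m)); lra.
apply/hcvgP; suff -> : J h = u by [].
have [rJ _ cC rep _] := dC.
have CJ := form_data_dom h dC; have CJu := csubspaceB (closed_form_sub cC) CJ Cu.
apply/eqP; rewrite -subr_eq0; apply/eqP/ip_eq0/le_anti; rewrite ip_ge0 andbT.
(* p(J h - u, J h - u) = (h, J h) - 2 (h, u) + p(u, u) <= L - 2 L + L. *)
apply: le_trans (closed_form_ge cC CJu) _.
rewrite (semi_inner_sqrB (closed_form_sub cC) (closed_form_inner cC) CJ Cu).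
rewrite (form_data_ip _ dC) (representsE rep)//.
have JL : ip h (J h) <= L by apply: (@cvg_ge_cst _ _ _ _ 0%N uL) => n _; exact: JC.
lra.
Qed.

Lemma form_sum_nondecreasing (A B : nat -> set (H * H)) :
  (forall n, nonneg_selfadjoint (A n)) -> (forall n, nonneg_selfadjoint (B n)) ->
  nondecreasing_rel A -> nondecreasing_rel B ->
  nondecreasing_rel (fun n => form_sum (A n) (B n)).
Proof.
move=> hA hB ndA ndB m n mn.
have [_ domm relm] := form_sumP (hA m) (hB m).
have [_ domn reln] := form_sumP (hA n) (hB n).
have [AA leA] := ndA _ _ mn; have [BB leB] := ndB _ _ mn.
rewrite /rel_le domm domn; split=> [x [Ax Bx]|x [Ax Bx]].
  by split; [exact: AA|exact: BB].
rewrite relm ?reln//; last by split; [exact: AA|exact: BB].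
by apply: lerD; [exact: leA|exact: leB].
Qed.

Lemma exists_form_data_seq (A : nat -> set (H * H)) :
  (forall n, nonneg_selfadjoint (A n)) ->
  exists (J_ : nat -> H -> H) (p_ : nat -> H -> H -> R),
    forall n, form_data (A n) (J_ n) (p_ n).
Proof.
move=> hA.
have /choice[Jp JpP] : forall n, exists Jp : (H -> H) * (H -> H -> R),
    form_data (A n) Jp.1 Jp.2.
  by move=> n; have [J [p d]] := exists_form_data (hA n); exists (J, p).
by exists (fun n => (Jp n).1), (fun n => (Jp n).2).
Qed.

Lemma form_sum_cvg (A B : nat -> set (H * H)) C D :
  (forall n, nonneg_selfadjoint (A n)) -> (forall n, nonneg_selfadjoint (B n)) ->
  nonneg_selfadjoint C -> nonneg_selfadjoint D ->
  nondecreasing_rel A -> nondecreasing_rel B ->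
  strong_resolvent_cvg A C -> strong_resolvent_cvg B D ->
  strong_resolvent_cvg (fun n => form_sum (A n) (B n)) (form_sum C D).
Proof.
move=> hA hB hC hD ndA ndB AC BD.
have [J_ [p_ dA]] := exists_form_data_seq hA.
have [K_ [q_ dB]] := exists_form_data_seq hB.
have [J [p dC]] := exists_form_data hC.
have [K [q dD]] := exists_form_data hD.
have hE n : nonneg_selfadjoint (form_sum (A n) (B n)).
  by have [] := form_sumP (hA n) (hB n).
have [hF domF _] := form_sumP hC hD.
have [L_ [r_ dE]] := exists_form_data_seq hE.
have [L [r dF]] := exists_form_data hF.
have [upA lowA] := form_data_limit dA dC ndA AC.
have [upB lowB] := form_data_limit dB dD ndB BD.
apply: (monotone_form_cvg dE dF); first exact: form_sum_nondecreasing.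
  move=> n x Fx; have [Cx Dx rE] := form_sum_data dC dD dF Fx.
  have [Ax leA] := upA n x Cx; have [Bx leB] := upB n x Dx.
  have Ex : rel_form_dom (form_sum (A n) (B n)) x.
    by have [_ -> _] := form_sumP (hA n) (hB n).
  by split=> //; have [_ _ ->] := form_sum_data (dA n) (dB n) (dE n) Ex; lra.
move=> x M xM.
have Ex n := form_sum_data (dA n) (dB n) (dE n) (xM n).1.
have ndp (X : nat -> set (H * H)) (I_ : nat -> H -> H) s_ n m :
    (forall n, form_data (X n) (I_ n) (s_ n)) ->
    nondecreasing_rel X -> rel_form_dom (X m) x -> (n <= m)%N -> s_ n x x <= s_ m x x.
  move=> dX ndX Xx nm; have [_ /(_ x Xx)] := ndX _ _ nm.
  by rewrite (form_data_rel_form (dX n)) (form_data_rel_form (dX m)) lecR lerD2r.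
(* Monotonicity decouples the two indices, so the suprema over n and over m can be taken one after
   the other. *)
have sumM n m : p_ n x x + q_ m x x - ip x x <= M.
  have [Ax Bx rE] := Ex (maxn n m); have [_] := xM (maxn n m); rewrite rE.
  have := ndp _ _ _ _ _ dA ndA Ax (leq_maxl n m).
  have := ndp _ _ _ _ _ dB ndB Bx (leq_maxr n m).
  lra.
have Cx m : rel_form_dom C x /\ p x x <= M + ip x x - q_ m x x.
  by apply: lowA => n; have [Ax _ _] := Ex n; split=> //; have := sumM n m; lra.
have [Dx qx] : rel_form_dom D x /\ q x x <= M + ip x x - p x x.
  by apply: lowB => m; have [_ Bx _] := Ex m; split=> //; have [_] := Cx m; lra.
have Fx : rel_form_dom (form_sum C D) x by rewrite domF; split=> //; have [] := Cx 0%N.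
by split=> //; have [_ _ ->] := form_sum_data dC dD dF Fx; lra.
Qed.

Lemma rinv_selfadjoint A : nonneg_selfadjoint A -> nonneg_selfadjoint (rinv A).
Proof.
move=> /exists_resolvent[J rJ ->]; rewrite rinv_resolvent_graph//.
exact/resolvent_graph_selfadjoint/resolvent_like_sub.
Qed.

Lemma resolvent_rinv A h : nonneg_selfadjoint A ->
  resolvent (rinv A) h = h - resolvent A h.
Proof.
move=> /exists_resolvent[J rJ ->]; rewrite rinv_resolvent_graph//.
by rewrite !resolvent_graph_resolvent.
Qed.

Lemma rel_le_resolvent A B : nonneg_selfadjoint A -> nonneg_selfadjoint B ->
  rel_le A B <-> forall h, ip h (resolvent B h) <= ip h (resolvent A h).
Proof.
move=> /exists_form_data[J [p dA]] /exists_form_data[K [q dB]].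
rewrite (rel_leP dA dB) (form_data_graph dA) (form_data_graph dB).
by split=> le_h h; move: (le_h h); rewrite !resolvent_graph_resolvent.
Qed.

Lemma rel_le_rinv A B : nonneg_selfadjoint A -> nonneg_selfadjoint B ->
  rel_le A B -> rel_le (rinv B) (rinv A).
Proof.
move=> hA hB /(rel_le_resolvent hA hB) le_h.
apply/rel_le_resolvent => [||h]; [exact: rinv_selfadjoint|exact: rinv_selfadjoint|].
by rewrite !resolvent_rinv// !ipDr !ipNr lerD2l lerN2.
Qed.

Lemma strong_resolvent_cvg_rinv (A : nat -> set (H * H)) C :
  (forall n, nonneg_selfadjoint (A n)) -> nonneg_selfadjoint C ->
  strong_resolvent_cvg A C -> strong_resolvent_cvg (fun n => rinv (A n)) (rinv C).
Proof.
move=> hA hC AC h; rewrite resolvent_rinv//.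
rewrite (_ : (fun n => _) = fun n => h - resolvent (A n) h); last first.
  by apply/funext => n; rewrite resolvent_rinv.
by apply: cvgB; [exact: cvg_cst|exact: AC].
Qed.

End Convergence.

Theorem corollary5p3 (R : realType) (H : hilbertType R)
    (A B : nat -> set (H * H)) (Ainf Binf : set (H * H))
    (hA : forall n, nonneg_selfadjoint (A n))
    (hB : forall n, nonneg_selfadjoint (B n))
    (hAinf : nonneg_selfadjoint Ainf) (hBinf : nonneg_selfadjoint Binf) :
  (nondecreasing_rel A -> nondecreasing_rel B ->
   strong_resolvent_cvg A Ainf -> strong_resolvent_cvg B Binf ->
   nondecreasing_rel (fun n => form_sum (A n) (B n)) /\
   strong_resolvent_cvg (fun n => form_sum (A n) (B n)) (form_sum Ainf Binf))
  /\
  (nonincreasing_rel A -> nonincreasing_rel B ->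
   strong_resolvent_cvg A Ainf -> strong_resolvent_cvg B Binf ->
   nonincreasing_rel (fun n => parallel_sum (A n) (B n)) /\
   strong_resolvent_cvg (fun n => parallel_sum (A n) (B n))
     (parallel_sum Ainf Binf)).
Proof.
split=> [ndA ndB cA cB|niA niB cA cB].
  by split; [exact: form_sum_nondecreasing|exact: form_sum_cvg].
have hA' n := rinv_selfadjoint (hA n); have hB' n := rinv_selfadjoint (hB n).
have hAinf' := rinv_selfadjoint hAinf; have hBinf' := rinv_selfadjoint hBinf.
have ndA : nondecreasing_rel (fun n => rinv (A n)).
  by move=> m n mn; apply: rel_le_rinv => //; exact: niA.
have ndB : nondecreasing_rel (fun n => rinv (B n)).
  by move=> m n mn; apply: rel_le_rinv => //; exact: niB.
have hS n : nonneg_selfadjoint (form_sum (rinv (A n)) (rinv (B n))).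
  by have [] := form_sumP (hA' n) (hB' n).
split=> [m n mn|].
  by apply: rel_le_rinv => //; exact: (form_sum_nondecreasing hA' hB' ndA ndB).
apply: strong_resolvent_cvg_rinv => //; first by have [] := form_sumP hAinf' hBinf'.
by apply: form_sum_cvg => //; exact: strong_resolvent_cvg_rinv.
Qed.
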